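(* Let $K\ge 2$, $n\ge 1$, let $\pi$ be any probability distribution on $[K]^n$, and let $\xi\in[0,n]$. Let $P_{\mathrm{MG}}$, $P_{\mathrm{R}}$ and $P_{\mathrm{NR}}$ be the Markov kernels defined in the context. Then for every $g:[K]^n\to\mathbb{R}$, \[ \mathrm{Var}(g,P_{\mathrm{NR}})\;\le\;\mathrm{Var}(g,P_{\mathrm{R}})\;\le\; c(K)\,\mathrm{Var}(g,P_{\mathrm{MG}})+\bigl[c(K)-1\bigr]\mathrm{Var}_\pi(g),\qquad c(K)=2(K-1), \] where in $\mathrm{Var}(g,P_{\mathrm{NR}})$ the function $g$ is regarded as the function $(c,v)\mapsto g(c)$ on the extended space, and $\mathrm{Var}_\pi(g)$ is the variance of $g(X)$ for $X\sim\pi$.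
   Context: Notation: $[K]=\{1,\dots,K\}$; for $c=(c_1,\dots,c_n)\in[K]^n$, $n_k(c)=\#\{i:c_i=k\}$; $c_{-i}$ is $c$ with the $i$-th entry removed and $(c_{-i},k)$ is $c$ with $c_i$ replaced by $k$; $\pi(c_i=k\mid c_{-i})=\pi((c_{-i},k))/\sum_{j\in[K]}\pi((c_{-i},j))$. Let $\mathcal{K}=\{(k,k')\in[K]^2:k<k'\}$ and, for $c\in[K]^n$, $p_c(k,k')=\frac{n_k(c)+n_{k'}(c)}{(K-1)n}$ for $(k,k')\in\mathcal{K}$ (a probability distribution on $\mathcal{K}$). For $c$ in the support of $\pi$, $i$ with $c_i=k_-$ and $k_+\neq k_-$, set \[ r(c,i,k_-,k_+)=\frac{n_{k_-}(c)}{n_{k_+}(c)+1}\cdot\frac{\pi(c_i=k_+\mid c_{-i})}{\pi(c_i=k_-\mid c_{-i})}. \] Marginal Gibbs kernel $P_{\mathrm{MG}}$ on $[K]^n$: from $c$, pick $i$ uniformly in $[n]$ and resample $c_i\sim\pi(c_i=\cdot\mid c_{-i})$, keeping $c_{-i}$; i.e. $P_{\mathrm{MG}}(c,c')=\frac1n\sum_{i=1}^n \mathbb 1(c'_{-i}=c_{-i})\pi(c_i=c'_i\mid c_{-i})$. Kernel $P_{\mathrm{R}}$ on $[K]^n$: from $c$, sample $(k,k')\sim p_c$; set $(k_-,k_+)=(k,k')$ or $(k',k)$ with probability $1/2$ each; if $n_{k_-}(c)=0$ set $c'=c$; otherwise pick $i$ uniformly from $\{i':c_{i'}=k_-\}$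 and set $c'=(c_{-i},k_+)$ with probability $\min\{1,r(c,i,k_-,k_+)\}$, else $c'=c$. Kernel $P_{\mathrm{NR}}$ on $[K]^n\times\{-1,+1\}^{\mathcal{K}}$ (velocity $v=(v_{k,k'})_{(k,k')\in\mathcal K}$), with refresh parameter $\xi$: from $(c,v)$, sample $(k,k')\sim p_c$ and then apply the kernel $\tilde P_{k,k'}$: (1) with probability $\xi/n$ replace $v_{k,k'}$ by $-v_{k,k'}$; (2) set $(k_-,k_+)=(k,k')$ if $v_{k,k'}=+1$ and $(k_-,k_+)=(k',k)$ if $v_{k,k'}=-1$; (3) if $n_{k_-}(c)=0$, set $c'=c$ and $v'$ equal to $v$ with component $v_{k,k'}$ negated; otherwise pick $i$ uniformly from $\{i':c_{i'}=k_-\}$ and with probability $\min\{1,r(c,i,k_-,k_+)\}$ set $(c',v')=((c_{-i},k_+),v)$, else set $c'=c$ and $v'$ equal to $v$ with $v_{k,k'}$ negated; (4) with probability $\xi/n$ negate $v'_{k,k'}$. $P_{\mathrm{NR}}$ has invariant distribution $\tilde\pi(c,v)=\pi(c)2^{-K(K-1)/2}$. Asymptotic variance: for a kernel $P$ with invariant distribution $\mu$ and a Markov chain $(X_t)$ with kernel $P$ and $X_0\sim\mu$, $\mathrm{Var}(g,P)=\lim_{T\to\infty}T\,\mathrm{Var}\bigl(\frac1T\sum_{t=1}^T g(X_t)\bigr)=\mathrm{Var}_\mu(g)+2\sum_{t\ge1}\mathrm{Cov}(g(X_0),g(X_t))$, with values in $[0,\infty]$. *)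

(* Defs.v *)
From HB Require Import structures.
From mathcomp Require Import all_boot all_order all_algebra.
From mathcomp Require Import all_classical all_reals all_analysis.
Set Implicit Arguments. Unset Strict Implicit. Unset Printing Implicit Defensive.
Import Order.TTheory GRing.Theory Num.Theory.
Local Open Scope ring_scope.

(* Configurations c in [K]^n  (index k in [K] is represented by 'I_K, i.e. k-1). *)
Notation cfg n K := {ffun 'I_n -> 'I_K}.
Notation kpair K := {p : 'I_K * 'I_K | (p.1 < p.2)%N}.
(* Velocities v in {-1,+1}^{\mathcal K}; true encodes +1, false encodes -1. *)
Notation vel K := {ffun kpair K -> bool}.
Notation xstate n K := (cfg n K * vel K)%type.

Definition ncount n K (c : cfg n K) (k : 'I_K) : nat := #|[pred i | c i == k]|.
Definition setc n K (c : cfg n K) (i : 'I_n) (k : 'I_K) : cfg n K :=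
  [ffun j => if j == i then k else c j].
Definition condp (R : realType) n K (pi : cfg n K -> R) (c : cfg n K) (i : 'I_n) (k : 'I_K) : R :=
  pi (setc c i k) / \sum_(j : 'I_K) pi (setc c i j).
Definition pc (R : realType) n K (c : cfg n K) (e : kpair K) : R :=
  (ncount c (val e).1 + ncount c (val e).2)%:R / ((K - 1) * n)%:R.
Definition rratio (R : realType) n K (pi : cfg n K -> R) (c : cfg n K) (i : 'I_n)
  (km kp : 'I_K) : R :=
  (ncount c km)%:R / (ncount c kp).+1%:R * (condp pi c i kp / condp pi c i km).

Definition PMG (R : realType) n K (pi : cfg n K -> R) (c c' : cfg n K) : R :=
  n%:R^-1 * \sum_(i < n)
     (if [forall j, (j != i) ==> (c' j == c j)] then condp pi c i (c' i) else 0).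

Definition moveR (R : realType) n K (pi : cfg n K -> R) (c : cfg n K) (km kp : 'I_K)
  (c' : cfg n K) : R :=
  if ncount c km == 0%N then (c' == c)%:R
  else (ncount c km)%:R^-1 * \sum_(i < n | c i == km)
     (Num.min 1 (rratio pi c i km kp) * (c' == setc c i kp)%:R
      + (1 - Num.min 1 (rratio pi c i km kp)) * (c' == c)%:R).

Definition PR (R : realType) n K (pi : cfg n K -> R) (c c' : cfg n K) : R :=
  \sum_(e : kpair K) pc R c e *
    (2^-1 * moveR pi c (val e).1 (val e).2 c' + 2^-1 * moveR pi c (val e).2 (val e).1 c').

Definition flipv K (v : vel K) (e : kpair K) : vel K :=
  [ffun e' => if e' == e then ~~ v e else v e'].
Definition flipK (R : realType) n K (q : R) (e : kpair K) (x y : xstate n K) : R :=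
  (1 - q) * (y == x)%:R + q * (y == (x.1, flipv x.2 e))%:R.
Definition mainK (R : realType) n K (pi : cfg n K -> R) (e : kpair K) (x y : xstate n K) : R :=
  let c := x.1 in let v := x.2 in
  let km := if v e then (val e).1 else (val e).2 in
  let kp := if v e then (val e).2 else (val e).1 in
  if ncount c km == 0%N then (y == (c, flipv v e))%:R
  else (ncount c km)%:R^-1 * \sum_(i < n | c i == km)
     (Num.min 1 (rratio pi c i km kp) * (y == (setc c i kp, v))%:R
      + (1 - Num.min 1 (rratio pi c i km kp)) * (y == (c, flipv v e))%:R).
Definition tildeP (R : realType) n K (pi : cfg n K -> R) (q : R) (e : kpair K)
  (x y : xstate n K) : R :=
  \sum_(z : xstate n K) \sum_(w : xstate n K)
     flipK q e x z * mainK pi e z w * flipK q e w y.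
Definition PNR (R : realType) n K (xi : R) (pi : cfg n K -> R) (x y : xstate n K) : R :=
  \sum_(e : kpair K) pc R x.1 e * tildeP pi (xi / n%:R) e x y.
Definition pitilde (R : realType) n K (pi : cfg n K -> R) (x : xstate n K) : R :=
  pi x.1 * (2 ^+ (K * (K - 1) %/ 2))^-1.

Definition pathprob (R : realType) (S : finType) (mu : S -> R) (P : S -> S -> R) (T : nat)
  (w : {ffun 'I_T.+1 -> S}) : R :=
  mu (w ord0) * \prod_(t < T) P (w (inord t)) (w (inord t.+1)).
Definition pathavg (R : realType) (S : finType) (g : S -> R) (T : nat)
  (w : {ffun 'I_T.+1 -> S}) : R :=
  T%:R^-1 * \sum_(t < T) g (w (inord t.+1)).
Definition varavg (R : realType) (S : finType) (mu : S -> R) (P : S -> S -> R)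
  (g : S -> R) (T : nat) : R :=
  \sum_(w : {ffun 'I_T.+1 -> S}) pathprob mu P w * (pathavg g w) ^+ 2
  - (\sum_(w : {ffun 'I_T.+1 -> S}) pathprob mu P w * pathavg g w) ^+ 2.
Definition asymvar (R : realType) (S : finType) (mu : S -> R) (P : S -> S -> R)
  (g : S -> R) : \bar R :=
  limn (fun T : nat => (T%:R * varavg mu P g T)%:E).
Definition varpi (R : realType) (S : finType) (mu : S -> R) (g : S -> R) : R :=
  \sum_x mu x * g x ^+ 2 - (\sum_x mu x * g x) ^+ 2.

(* Main.v *)
(** Write <f, h> for the inner product of L^2(mu). For any kernel P with invariant
    law mu and centered g, split g = z + (I - P) u with z orthogonal to the range
    of I - P. Then z is fixed by P, the variance of the path sums grows like
    T^2 |z|^2 when z <> 0, and otherwise the asymptotic variance is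
    2 <g, u> - |g|^2.

    P_NR is compared with P_R through its symmetric part: skew detailed balance
    gives <h, P f> + <P h, f> = 2 <h, P_R f> whenever f depends on c only. With
    ub the projection of u on such functions, <(I - P)(u - ub), u - ub> >= 0 then
    reads <ub, (I - P_R) ub> <= <g, ub>, and the variational formula for P_R
    gives <g, u> <= <g, (I - P_R)^-1 g>.

    For P_MG, the Dirichlet forms satisfy E_MG <= c(K) E_R because the
    off-diagonal entries do: with c_i = a, the claim reduces to
    pi(b) <= (n_a + n_b) / n_a * min(1, n_a / (n_b + 1) * pi(b) / pi(a)),
    where pi(.) = pi(c_i = . | c_{-i}) <= 1. *)

Require Import Defs.
From HB Require Import structures.
From mathcomp Require Import all_boot all_order all_algebra.
From mathcomp Require Import all_classical all_reals all_analysis.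
From mathcomp Require Import ring lra.
Import Order.TTheory GRing.Theory Num.Theory.
Local Open Scope ring_scope.

Set Implicit Arguments.
Unset Strict Implicit.
Unset Printing Implicit Defensive.

(** * The semi-inner product of L^2(mu) *)

Section Dot.
Variables (R : realType) (S : finType) (mu : S -> R).

Definition dot (f h : S -> R) : R := \sum_x mu x * (f x * h x).

Lemma eq_dot f f' h h' : f =1 f' -> h =1 h' -> dot f h = dot f' h'.
Proof. by move=> ff hh; apply: eq_bigr => x _; rewrite ff hh. Qed.

Lemma dotC f h : dot f h = dot h f.
Proof. by apply: eq_bigr => x _; rewrite (mulrC (f x)). Qed.

Lemma dotDl f f' h : dot (f \+ f') h = dot f h + dot f' h.
Proof. by rewrite -big_split; apply: eq_bigr => x _ /=; ring. Qed.

Lemma dotBl f f' h : dot (f \- f') h = dot f h - dot f' h.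
Proof. by rewrite -sumrB; apply: eq_bigr => x _ /=; ring. Qed.

Lemma dotZl a f h : dot (a \*o f) h = a * dot f h.
Proof. by rewrite mulr_sumr; apply: eq_bigr => x _ /=; ring. Qed.

Lemma dotDr f h h' : dot f (h \+ h') = dot f h + dot f h'.
Proof. by rewrite dotC dotDl !(dotC f). Qed.

Lemma dotBr f h h' : dot f (h \- h') = dot f h - dot f h'.
Proof. by rewrite dotC dotBl !(dotC f). Qed.

Lemma dotZr a f h : dot f (a \*o h) = a * dot f h.
Proof. by rewrite dotC dotZl (dotC f). Qed.

Hypothesis mu_ge0 : forall x, 0 <= mu x.

Lemma dot_ge0 f : 0 <= dot f f.
Proof. by apply: sumr_ge0 => x _; rewrite mulr_ge0 // -expr2 sqr_ge0. Qed.

(** Since [mu] may vanish at some states, a function of norm zero is only zero almost everywhere.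
    Equalities in L^2(mu) are therefore expressed below as [dot f f = 0] for the difference. *)
Lemma null_mul f x : dot f f = 0 -> mu x * f x = 0.
Proof.
move=> /eqP; rewrite psumr_eq0; last first.
  by move=> y _; rewrite mulr_ge0 // -expr2 sqr_ge0.
move=> /allP /(_ x); rewrite mem_index_enum => /(_ isT) /=.
by rewrite !mulf_eq0 orbb => /orP[] /eqP ->; rewrite ?mul0r ?mulr0.
Qed.

Lemma null_dotl f h : dot f f = 0 -> dot f h = 0.
Proof. by move=> f0; apply: big1 => x _; rewrite mulrA null_mul ?mul0r. Qed.

Lemma null_dotr f h : dot f f = 0 -> dot h f = 0.
Proof. by rewrite dotC; apply: null_dotl. Qed.

(** Expanding |f + h|^2 and |f - h|^2 gives a crude Cauchy-Schwarz bound, enough to keep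
    correlations bounded uniformly in time. *)
Lemma normr_dot_le f h : `|dot f h| <= dot f f + dot h h.
Proof.
have := dot_ge0 (f \+ h); have := dot_ge0 (f \- h).
have := dot_ge0 f; have := dot_ge0 h.
rewrite !dotBl !dotBr !dotDl !dotDr (dotC h f) ler_norml => *; lra.
Qed.

End Dot.

(** * Orthogonal projection onto the range of a linear map *)

Section Projection.
Variables (R : realType) (S I : finType) (mu : S -> R).
Variables (L : (I -> R) -> (S -> R)).
Hypothesis mu_ge0 : forall x, 0 <= mu x.
Hypothesis eqL : forall f h, f =1 h -> L f =1 L h.
Hypothesis LD : forall f h, L (f \+ h) =1 L f \+ L h.
Hypothesis LZ : forall a f, L (a \*o f) =1 a \*o L f.

(* Gram-Schmidt. The last clause says that L u lies in the span of the L (e x). *)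
Lemma dot_projection_seq (T : eqType) (e : T -> I -> R) (s : seq T) (g : S -> R) :
  exists u,
    (forall x, x \in s -> dot mu (g \- L u) (L (e x)) = 0) /\
    (forall k, (forall x, x \in s -> dot mu k (L (e x)) = 0) -> dot mu k (L u) = 0).
Proof.
have L0 f : L (0 \*o f) =1 fun=> 0 by move=> x; rewrite LZ /= mul0r.
elim: s g => [|x s IH] g.
  exists (0 \*o fun=> 0); split=> // k _.
  by apply: big1 => x _; rewrite L0 !mulr0.
have [w [wo wc]] := IH (L (e x)); have [u [uo uc]] := IH g.
have gw := wc _ uo.
have ex : dot mu (g \- L u) (L (e x)) = dot mu (g \- L u) (L (e x) \- L w).
  by rewrite dotBr gw subr0.
(* If the residual of [L (e x)] after projection on the earlier vectors is null, the new vector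
   imposes no new condition and [u] is kept. *)
have [d0|d0] := eqVneq (dot mu (L (e x) \- L w) (L (e x) \- L w)) 0.
  exists u; split=> [y|k kx].
    rewrite inE => /orP[/eqP ->|/uo //].
    by rewrite ex null_dotr.
  by apply: uc => y ys; apply: kx; rewrite inE ys orbT.
(* The usual Gram-Schmidt coefficient along the residual [L (e x) \- L w]. *)
pose a := dot mu (g \- L u) (L (e x)) / dot mu (L (e x) \- L w) (L (e x) \- L w).
pose u' := u \+ (a \*o (e x \+ (-1 \*o w))).
have Lu' : L u' =1 L u \+ (a \*o (L (e x) \- L w)).
  by move=> z; rewrite LD /= LZ /= LD /= LZ /=; ring.
have gu' h : dot mu (g \- L u') h
    = dot mu (g \- L u) h - a * dot mu (L (e x) \- L w) h.
  rewrite -dotZl -dotBl; apply: eq_dot => // z.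
  by have /= -> := Lu' z; ring.
exists u'; split=> [y|k kx].
  rewrite inE => /orP[/eqP ->|ys]; rewrite gu'; last by rewrite uo // wo // mulr0 subr0.
  have -> : dot mu (L (e x) \- L w) (L (e x)) = dot mu (L (e x) \- L w) (L (e x) \- L w).
    by rewrite [RHS]dotBr (wc _ wo) subr0.
  by rewrite divfK // subrr.
have ks y : y \in s -> dot mu k (L (e y)) = 0.
  by move=> ys; apply: kx; rewrite inE ys orbT.
rewrite (eq_dot mu (f' := k) (h' := L u \+ (a \*o (L (e x) \- L w)))) //.
rewrite dotDr dotZr dotBr (wc _ ks) (uc _ ks) kx ?mem_head //; ring.
Qed.

(** Gram-Schmidt is run on the images of the point indicators, whose linear combinations exhaust the
    functions on [I]. *)
Lemma dot_projection g : exists u, forall h, dot mu (g \- L u) (L h) = 0.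
Proof.
have [u [uo _]] := dot_projection_seq (fun x z => (z == x)%:R) (enum I) g.
exists u => h.
have L0 f : L (0 \*o f) =1 fun=> 0 by move=> x; rewrite LZ /= mul0r.
have [a] : exists a, h =1 (fun z => \sum_(x <- enum I) a x * (z == x)%:R).
  exists h => z; rewrite big_enum /= (bigD1 z) //= eqxx mulr1 big1 ?addr0 // => x xz.
  by rewrite eq_sym (negbTE xz) mulr0.
have : {subset enum I <= enum I} by [].
elim: {1 3}(enum I) h => [|x s IH] h sI hE.
  apply: big1 => z _; rewrite (eqL (h := 0 \*o h)) ?L0 ?mulr0 // => y.
  by rewrite hE big_nil /= mul0r.
pose h' z := \sum_(y <- s) a y * (z == y)%:R.
have hE' : h =1 (a x \*o (fun z => (z == x)%:R)) \+ h'.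
  by move=> z; rewrite hE big_cons.
rewrite (eq_dot mu (f' := g \- L u)
  (h' := (a x \*o L (fun z => (z == x)%:R)) \+ L h')) //;
  last by move=> z; rewrite (eqL hE') LD /= LZ.
rewrite dotDr dotZr uo ?mulr0 ?add0r; last by apply: sI; rewrite mem_head.
by apply: IH => // y ys; apply: sI; rewrite inE ys orbT.
Qed.

End Projection.

(** * Kernels as operators on functions, and invariant laws *)

Definition mop (R : realType) (S : finType) (P : S -> S -> R) (f : S -> R) (x : S) : R :=
  \sum_y P x y * f y.

Section Op.
Variables (R : realType) (S : finType) (P : S -> S -> R).

Lemma eq_mop f f' : f =1 f' -> mop P f =1 mop P f'.
Proof. by move=> ff x; apply: eq_bigr => y _; rewrite ff. Qed.

Lemma mopD f h : mop P (f \+ h) =1 mop P f \+ mop P h.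
Proof. by move=> x; rewrite /= -big_split; apply: eq_bigr => y _ /=; ring. Qed.

Lemma mopB f h : mop P (f \- h) =1 mop P f \- mop P h.
Proof. by move=> x; rewrite /= -sumrB; apply: eq_bigr => y _ /=; ring. Qed.

Lemma mopZ a f : mop P (a \*o f) =1 a \*o mop P f.
Proof. by move=> x; rewrite /= mulr_sumr; apply: eq_bigr => y _ /=; ring. Qed.

Definition lap (f : S -> R) : S -> R := f \- mop P f.

Lemma lapD f h : lap (f \+ h) =1 lap f \+ lap h.
Proof. by move=> x; rewrite /lap /= mopD /=; ring. Qed.

Lemma lapB f h : lap (f \- h) =1 lap f \- lap h.
Proof. by move=> x; rewrite /lap /= mopB /=; ring. Qed.

Lemma lapZ a f : lap (a \*o f) =1 a \*o lap f.
Proof. by move=> x; rewrite /lap /= mopZ /=; ring. Qed.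

End Op.

(** Row sums are required to be 1 only where [mu] is nonzero: outside the support of [pi] the
    denominator in [condp] may be 0, the quotient is then 0 by convention, and rows of [PMG] can
    fall short of 1. *)
Record stationary (R : realType) (S : finType) (mu : S -> R) (P : S -> S -> R) : Prop :=
  Stationary {
    stat_mu : forall x, 0 <= mu x;
    stat_ge0 : forall x y, 0 <= P x y;
    stat_row : forall x, mu x * \sum_y P x y = mu x;
    stat_inv : forall y, \sum_x mu x * P x y = mu y }.

(** * Contractivity of a stationary kernel on L^2(mu) *)

Section Stationary.
Variables (R : realType) (S : finType) (mu : S -> R) (P : S -> S -> R).
Hypothesis sP : stationary mu P.
Local Notation "''[' f , h ]" := (dot mu f h) (format "''[' f ,  h ]").
Let mu_ge0 := stat_mu sP.

Lemma sum_mop h : \sum_x mu x * mop P h x = \sum_x mu x * h x.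
Proof.
under eq_bigr do rewrite mulr_sumr; rewrite exchange_big /=.
apply: eq_bigr => y _; rewrite -[in RHS](stat_inv sP) mulr_suml.
by apply: eq_bigr => x _; rewrite mulrA.
Qed.

(* |f|^2 - |Pf|^2 is the mean conditional variance. *)
Lemma mop_contract f : '[mop P f, mop P f] <= '[f, f].
Proof.
rewrite -subr_ge0.
suff -> : '[f, f] - '[mop P f, mop P f] =
    \sum_x mu x * \sum_y P x y * (f y - mop P f x) ^+ 2.
  apply: sumr_ge0 => x _; rewrite mulr_ge0 //; apply: sumr_ge0 => y _.
  by rewrite mulr_ge0 ?sqr_ge0 ?(stat_ge0 sP).
have -> : '[f, f] = \sum_x mu x * mop P (fun y => f y * f y) x by rewrite sum_mop.
rewrite /dot -sumrB; apply: eq_bigr => x _.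
have -> m : \sum_y P x y * (f y - m) ^+ 2 =
    mop P (fun y => f y * f y) x - 2 * m * mop P f x + (\sum_y P x y) * m ^+ 2.
  rewrite /mop mulr_sumr mulr_suml -sumrB -big_split /=.
  by apply: eq_bigr => y _; ring.
have := stat_row sP x; move: (\sum_y _) => s e.
by rewrite mulrDr [X in _ = _ + X]mulrA e; ring.
Qed.

Lemma null_mop f : '[f, f] = 0 -> '[mop P f, mop P f] = 0.
Proof.
by move=> f0; apply: le_anti; rewrite dot_ge0 // andbT -f0 mop_contract.
Qed.

Lemma null_iter_mop f k : '[f, f] = 0 -> '[iter k (mop P) f, iter k (mop P) f] = 0.
Proof. by move=> f0; elim: k => //= k /null_mop. Qed.

Lemma iter_mop_contract f k : '[iter k (mop P) f, iter k (mop P) f] <= '[f, f].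
Proof. by elim: k => //= k; apply: le_trans; apply: mop_contract. Qed.

Lemma iter_mopD f h k : iter k (mop P) (f \+ h) =1 iter k (mop P) f \+ iter k (mop P) h.
Proof. by elim: k => //= k IH x; rewrite (eq_mop _ IH) mopD. Qed.

Lemma iter_mopB f h k : iter k (mop P) (f \- h) =1 iter k (mop P) f \- iter k (mop P) h.
Proof. by elim: k => //= k IH x; rewrite (eq_mop _ IH) mopB. Qed.

(** One has 2 <(I - P) f, f> = |(I - P) f|^2 + (|f|^2 - |P f|^2), and both terms are nonnegative.
    The same identity gives [null_lap]. *)
Lemma lap_dot_ge0 f : 0 <= '[lap P f, f].
Proof.
have := dot_ge0 mu_ge0 (f \- mop P f); have := mop_contract f.
rewrite /lap !dotBl !dotBr (dotC mu (mop P f) f) => *; lra.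
Qed.

Lemma null_lap f : '[lap P f, f] = 0 -> '[lap P f, lap P f] = 0.
Proof.
move=> e; apply: le_anti; rewrite dot_ge0 // andbT; move: e.
have := mop_contract f.
rewrite /lap !dotBl !dotBr (dotC mu (mop P f) f) => *; lra.
Qed.


End Stationary.

(** * Extension of a path by one state *)

Section PathExtension.
Variables (S : finType) (T : nat).

Definition path_rcons (w : {ffun 'I_T.+1 -> S}) (y : S) : {ffun 'I_T.+2 -> S} :=
  [ffun i => if unlift ord_max i is Some j then w j else y].

Lemma path_rcons_inord w y t : (t <= T)%N -> path_rcons w y (inord t) = w (inord t).
Proof.
move=> tT; have -> : inord t = lift ord_max (inord t : 'I_T.+1) :> 'I_T.+2.
  by apply: val_inj; rewrite [RHS]lift_max [LHS]inordK ?[RHS]inordK // ltnS leqW.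
by rewrite ffunE liftK.
Qed.

Lemma path_rcons_last w y : path_rcons w y (inord T.+1) = y.
Proof.
have -> : inord T.+1 = ord_max :> 'I_T.+2 by apply: val_inj; rewrite /= inordK.
by rewrite ffunE unlift_none.
Qed.

Lemma sum_path_rcons (R : nmodType) (F : {ffun 'I_T.+2 -> S} -> R) :
  \sum_w F w = \sum_w \sum_y F (path_rcons w y).
Proof.
rewrite pair_big /= (reindex (fun p => path_rcons p.1 p.2)) //=.
exists (fun w => ([ffun j => w (lift ord_max j)], w ord_max)).
  move=> [w y] _ /=; congr (_, _); last by rewrite ffunE unlift_none.
  by apply/ffunP => j; rewrite !ffunE liftK.
move=> w _; apply/ffunP => i; rewrite ffunE /=.
by case: unliftP => [j ->|->] //; rewrite ffunE.
Qed.

End PathExtension.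

(** * First and second moments of path sums *)

Section PathMoments.
Variables (R : realType) (S : finType) (mu : S -> R) (P : S -> S -> R).
Hypothesis sP : stationary mu P.
Local Notation "''[' f , h ]" := (dot mu f h) (format "''[' f ,  h ]").
Let mu_ge0 := stat_mu sP.

Definition pathsum (g : S -> R) T (w : {ffun 'I_T.+1 -> S}) : R :=
  \sum_(t < T) g (w (inord t.+1)).

Lemma pathprob_rcons T (w : {ffun 'I_T.+1 -> S}) y :
  pathprob mu P (path_rcons w y) = pathprob mu P w * P (w (inord T)) y.
Proof.
have inord0 m : inord 0 = ord0 :> 'I_m.+1 by apply: val_inj; rewrite /= inordK.
rewrite /pathprob -!inord0 path_rcons_inord // big_ord_recr /= path_rcons_inord //.
rewrite path_rcons_last mulrA; congr (_ * _ * _).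
apply: eq_bigr => t _; rewrite !path_rcons_inord //; exact: ltnW.
Qed.

Lemma pathsum_rcons g T (w : {ffun 'I_T.+1 -> S}) y :
  pathsum g (path_rcons w y) = pathsum g w + g y.
Proof.
rewrite /pathsum big_ord_recr /= path_rcons_last; congr (_ + _).
by apply: eq_bigr => t _; rewrite path_rcons_inord.
Qed.

(** By invariance no mass flows into a [mu]-null state: each mu x * P x y is 0, so the last step or,
    by induction, the shorter path has weight 0. This lets [pathE_row] treat row sums as 1 although
    [stat_row] says so only on the support. *)
Lemma pathprob_last0 T (w : {ffun 'I_T.+1 -> S}) :
  mu (w (inord T)) = 0 -> pathprob mu P w = 0.
Proof.
elim: T w => [|T IH] w w0.
  rewrite /pathprob -[X in mu (w X)](_ : inord 0 = ord0) ?w0 ?mul0r //.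
  by apply: val_inj; rewrite /= inordK.
have -> : w = path_rcons [ffun j => w (lift ord_max j)] (w ord_max).
  apply/ffunP => i; rewrite ffunE.
  by case: unliftP => [j ->|->] //; rewrite ffunE.
have omax : ord_max = inord T.+1 :> 'I_T.+2 by apply: val_inj; rewrite /= inordK.
rewrite pathprob_rcons; set w' := finfun _; set x := w' _.
have /eqP := stat_inv sP (w ord_max).
rewrite omax w0 psumr_eq0; last by move=> z _; rewrite mulr_ge0 ?(stat_ge0 sP).
move=> /allP/(_ x); rewrite mem_index_enum => /(_ isT) /=.
by rewrite mulf_eq0 => /orP[] /eqP e; rewrite ?e ?mulr0 // IH ?mul0r.
Qed.

Definition pathE T (Phi : {ffun 'I_T.+1 -> S} -> R) : R :=
  \sum_w pathprob mu P w * Phi w.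

(** Tower property: conditioning on all states but the last. *)
Lemma pathE_rcons T (Phi : {ffun 'I_T.+2 -> S} -> R) :
  pathE Phi = pathE (fun w => \sum_y P (w (inord T)) y * Phi (path_rcons w y)).
Proof.
rewrite /pathE sum_path_rcons; apply: eq_bigr => w _.
by rewrite mulr_sumr; apply: eq_bigr => y _; rewrite pathprob_rcons mulrA.
Qed.

Lemma pathE_row T (Phi : {ffun 'I_T.+1 -> S} -> R) :
  pathE (fun w => (\sum_y P (w (inord T)) y) * Phi w) = pathE Phi.
Proof.
apply: eq_bigr => w _.
have [w0|w0] := eqVneq (mu (w (inord T))) 0; first by rewrite pathprob_last0 ?mul0r.
have -> : \sum_y P (w (inord T)) y = 1; last by rewrite mul1r.
by apply: (mulfI w0); rewrite (stat_row sP) mulr1.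
Qed.

Lemma pathED T (Phi Psi : {ffun 'I_T.+1 -> S} -> R) :
  pathE (fun w => Phi w + Psi w) = pathE Phi + pathE Psi.
Proof. by rewrite -big_split; apply: eq_bigr => w _ /=; rewrite mulrDr. Qed.

Lemma pathEZ T a (Phi : {ffun 'I_T.+1 -> S} -> R) :
  pathE (fun w => a * Phi w) = a * pathE Phi.
Proof. by rewrite mulr_sumr; apply: eq_bigr => w _ /=; rewrite mulrCA. Qed.

Lemma eq_pathE T (Phi Psi : {ffun 'I_T.+1 -> S} -> R) :
  Phi =1 Psi -> pathE Phi = pathE Psi.
Proof. by move=> e; apply: eq_bigr => w _; rewrite e. Qed.

Lemma pathE_last T h : pathE (T := T) (fun w => h (w (inord T))) = \sum_x mu x * h x.
Proof.
elim: T h => [|T IH] h.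
  rewrite /pathE (reindex (fun x : S => [ffun => x] : {ffun 'I_1 -> S})) /=.
    by apply: eq_bigr => x _; rewrite /pathprob big_ord0 mulr1 !ffunE.
  exists (fun w : {ffun 'I_1 -> S} => w ord0) => [x _|w _]; first by rewrite ffunE.
  by apply/ffunP => i; rewrite ffunE (ord1 i).
rewrite pathE_rcons -(sum_mop sP) -IH; apply: eq_pathE => w.
by apply: eq_bigr => y _; rewrite path_rcons_last.
Qed.

(** The index [k] is the lag between the time of [g] and the final time. Averaging over the last
    step replaces [h] by [mop P h] in the earlier terms, and the term of lag 0 comes from the last
    state itself. *)
Lemma pathE_sum_last g T h :
  pathE (T := T) (fun w => pathsum g w * h (w (inord T)))
  = \sum_(k < T) '[g, iter k (mop P) h].
Proof.
elim: T h => [|T IH] h.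
  rewrite big_ord0; apply: big1 => w _.
  by rewrite /pathsum big_ord0 mul0r mulr0.
rewrite pathE_rcons big_ord_recl /=.
under [in RHS]eq_bigr => k _ do rewrite -iterS iterSr.
rewrite -IH -[X in X + _](sum_mop sP (fun x => g x * h x)) -(pathE_last T) addrC.
rewrite -pathED; apply: eq_pathE => w.
rewrite /mop mulr_sumr -big_split; apply: eq_bigr => y _ /=.
by rewrite pathsum_rcons path_rcons_last; ring.
Qed.

Lemma pathE_sum g T : pathE (@pathsum g T) = T%:R * \sum_x mu x * g x.
Proof.
elim: T => [|T IH].
  rewrite mul0r; apply: big1 => w _; by rewrite /pathsum big_ord0 mulr0.
rewrite pathE_rcons -natr1 mulrDl mul1r -IH -(sum_mop sP) -(pathE_last T).
rewrite -[X in _ = X + _]pathE_row -pathED; apply: eq_pathE => w.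
rewrite mulr_suml -big_split; apply: eq_bigr => y _ /=.
by rewrite pathsum_rcons mulrDr.
Qed.

(** Adding a state y turns s^2 into s^2 + 2 s g(y) + g(y)^2; the cross term is [pathE_sum_last]
    applied to [mop P g], whence the lags [k.+1]. *)
Lemma pathE_sum2 g T : pathE (T := T) (fun w => pathsum g w ^+ 2)
  = T%:R * '[g, g] + 2 * \sum_(t < T) \sum_(k < t) '[g, iter k.+1 (mop P) g].
Proof.
elim: T => [|T IH].
  rewrite !big_ord0 mulr0 mul0r addr0; apply: big1 => w _.
  by rewrite /pathsum big_ord0 expr0n mulr0.
rewrite pathE_rcons big_ord_recr /= -natr1 mulrDl mul1r mulrDr addrACA -IH.
under [X in _ + (_ + 2 * X)]eq_bigr => k _ do rewrite -iterS iterSr.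
rewrite -pathE_sum_last -[X in _ + (X + _)](sum_mop sP (fun x => g x * g x)) -(pathE_last T).
rewrite -pathEZ -[X in _ = X + _]pathE_row -!pathED; apply: eq_pathE => w.
rewrite /mop !(mulr_sumr, mulr_suml) -!big_split; apply: eq_bigr => y _ /=.
by rewrite pathsum_rcons; ring.
Qed.

Lemma pathE1 T : \sum_x mu x = 1 -> pathE (T := T) (fun=> 1) = 1.
Proof.
move=> m1; rewrite (pathE_last T (fun=> 1)).
by under eq_bigr do rewrite mulr1.
Qed.

Lemma varavg_centered g T : \sum_x mu x = 1 ->
  let g0 x := g x - \sum_y mu y * g y in
  T%:R * varavg mu P g T = T%:R^-1 * pathE (T := T) (fun w => pathsum g0 w ^+ 2).
Proof.
(* For [T = 0] both sides vanish, the inverse of 0 being 0. *)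
move=> m1 g0; have [->|T0] := posnP T; first by rewrite mul0r invr0 mul0r.
have nT : T%:R != 0 :> R by rewrite pnatr_eq0 -lt0n.
set m := \sum_y mu y * g y in g0 *.
have m0 : pathE (T := T) (fun w => T%:R^-1 * pathsum g w) = m.
  by rewrite pathEZ pathE_sum mulrA mulVf ?mul1r.
have -> : varavg mu P g T
    = pathE (T := T) (fun w => (T%:R^-1 * pathsum g w) ^+ 2) - m ^+ 2.
  by rewrite -m0.
have -> : pathE (T := T) (fun w => pathsum g0 w ^+ 2) =
    T%:R ^+ 2 * (pathE (T := T) (fun w => (T%:R^-1 * pathsum g w) ^+ 2)
      + (- (2 * m) * pathE (T := T) (fun w => T%:R^-1 * pathsum g w)
      + m ^+ 2 * pathE (T := T) (fun=> 1))).
  rewrite -!pathEZ -!pathED -pathEZ; apply: eq_pathE => w.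
  have -> : pathsum g0 w = pathsum g w - T%:R * m.
    by rewrite /pathsum sumrB sumr_const card_ord mulr_natl.
  by field.
by rewrite m0 pathE1 //; field.
Qed.

End PathMoments.

(** * The asymptotic variance through the Poisson equation *)

Section AsymptoticVariance.
Variables (R : realType) (S : finType) (mu : S -> R) (P : S -> S -> R).
Hypothesis sP : stationary mu P.
Local Notation "''[' f , h ]" := (dot mu f h) (format "''[' f ,  h ]").
Let mu_ge0 := stat_mu sP.

Lemma lap_projection g : exists u, forall h, '[g \- lap P u, lap P h] = 0.
Proof.
apply: dot_projection => // [f h e x|f h x|a f x].
- by rewrite /lap /= e (eq_mop _ e).
- exact: lapD.
- exact: lapZ.
Qed.

(** Orthogonality tested at [h := z] gives <z, (I - P) z> = 0, and [null_lap] concludes: [z] is a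
    fixed point of [P] almost everywhere. *)
Lemma ortho_null_lap z : (forall h, '[z, lap P h] = 0) -> '[lap P z, lap P z] = 0.
Proof. by move=> zo; apply: (null_lap sP); rewrite dotC zo. Qed.

Lemma iter_mop_lap u k : iter k (mop P) (lap P u) =1 lap P (iter k (mop P) u).
Proof. by elim: k => //= k IH x; rewrite (eq_mop _ IH) mopB. Qed.

Lemma eq_iter_mop f h k : f =1 h -> iter k (mop P) f =1 iter k (mop P) h.
Proof. by move=> e; elim: k => //= k IH; apply: eq_mop. Qed.

(** [z] is fixed only up to a null function; null functions stay null under iteration and do not
    change inner products. *)
Lemma dot_iter_fixed z h k : '[lap P z, lap P z] = 0 -> '[h, iter k (mop P) z] = '[h, z].
Proof.
move=> z0; elim: k => [//|k IH]; rewrite iterSr -[RHS]IH.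
have e : mop P z =1 z \- lap P z by move=> x; rewrite /lap /=; ring.
rewrite (eq_dot mu (f' := h) (h' := iter k (mop P) z \- iter k (mop P) (lap P z))) //.
  by rewrite dotBr (null_dotr mu_ge0 h (null_iter_mop sP k z0)) subr0.
by move=> x; rewrite (eq_iter_mop _ e) iter_mopB.
Qed.

(** By [pathE_sum2], this is the second moment of [pathsum g] over [T] steps. *)
Definition pathvar g T : R :=
  T%:R * '[g, g] + 2 * \sum_(t < T) \sum_(k < t) '[g, iter k.+1 (mop P) g].

Lemma sum_lap_iter h v t :
  \sum_(k < t) '[h, iter k.+1 (mop P) (lap P v)] = '[h, mop P v] - '[h, iter t.+1 (mop P) v].
Proof.
elim: t => [|t IH]; first by rewrite big_ord0 subrr.
rewrite big_ord_recr /= IH.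
have -> : '[h, mop P (iter t (mop P) (lap P v))]
    = '[h, iter t.+1 (mop P) v] - '[h, mop P (iter t.+1 (mop P) v)].
  by rewrite -dotBr; apply: eq_dot => // x; rewrite -iterS iter_mop_lap.
by rewrite addrA subrK.
Qed.

(** The sum over lags telescopes to <f, P v> - <f, P^(t+1) v>. The last terms must still have
    bounded sums over t, and a second telescoping provides this without any decay of correlations,
    so periodic and reducible kernels are covered. *)
Lemma pathvar_lap v : exists B, forall T,
  `|pathvar (lap P v) T - T%:R * (2 * '[lap P v, v] - '[lap P v, lap P v])| <= B.
Proof.
set f := lap P v.
(* Now [v] itself is split: its fixed part [z] is orthogonal to [f], and the remainder (I - P) w
   telescopes again. *)
have [w wo] := lap_projection v; set z := v \- lap P w in wo.
have z0 := ortho_null_lap wo.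
have fz : '[f, z] = 0 by rewrite dotC wo.
pose C T := '[f, mop P w] - '[f, iter T.+1 (mop P) w].
have sumv T : \sum_(t < T) '[f, iter t.+1 (mop P) v] = C T.
  rewrite /C -sum_lap_iter; apply: eq_bigr => t _.
  rewrite [LHS](eq_dot mu (f' := f)
    (h' := iter t.+1 (mop P) z \+ iter t.+1 (mop P) (lap P w))) //.
    by rewrite dotDr dot_iter_fixed // fz add0r.
  move=> x; rewrite -iter_mopD; apply: eq_iter_mop => y; rewrite /z /=; ring.
have pvE T : pathvar f T = T%:R * (2 * '[f, v] - '[f, f]) - 2 * C T.
  rewrite /pathvar; under eq_bigr do rewrite sum_lap_iter.
  rewrite sumrB sumr_const card_ord sumv.
  have -> : '[f, mop P v] = '[f, v] - '[f, f].
    by rewrite -dotBr; apply: eq_dot => // x; rewrite /f /lap /=; ring.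
  by rewrite -mulr_natl; ring.
(* [C T] consists of two correlations, each at most |f|^2 + |w|^2, and enters [pvE] with a factor
   2. *)
exists (4 * ('[f, f] + '[w, w])) => T; rewrite pvE addrC addKr.
rewrite normrN normrM (ger0_norm (x := 2)) //.
have -> : 4 * ('[f, f] + '[w, w]) = 2 * (2 * ('[f, f] + '[w, w])) by ring.
rewrite ler_pM2l ?ltr0n // /C (le_trans (ler_normB _ _)) //.
have bound k : `|'[f, iter k (mop P) w]| <= '[f, f] + '[w, w].
  apply: le_trans (normr_dot_le mu_ge0 _ _) _.
  by rewrite lerD2l iter_mop_contract.
by have := lerD (bound 1) (bound T.+1); rewrite mulr_natl mulr2n.
Qed.

Lemma sum_ord_nat T : 2 * \sum_(t < T) t%:R = T%:R ^+ 2 - T%:R :> R.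
Proof.
elim: T => [|T IH]; first by rewrite big_ord0; ring.
by rewrite big_ord_recr /= mulrDr IH -natr1; ring.
Qed.

(** The fixed part [z] has correlation |z|^2 at every lag and is orthogonal to all iterates of (I -
    P) u, so cross terms vanish; its total weight is T + T (T - 1) = T^2. *)
Lemma pathvar_split g u T : (forall h, '[g \- lap P u, lap P h] = 0) ->
  pathvar g T = T%:R ^+ 2 * '[g \- lap P u, g \- lap P u] + pathvar (lap P u) T.
Proof.
set z := g \- lap P u => zo.
have z0 := ortho_null_lap zo; set f := lap P u.
have gE : g =1 z \+ f by move=> x; rewrite /z /f /=; ring.
have corr k : '[g, iter k (mop P) g] = '[z, z] + '[f, iter k (mop P) f].
  rewrite (eq_dot mu (f' := z \+ f) (h' := iter k (mop P) z \+ iter k (mop P) f)) //.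
    rewrite (dotDl mu z f) !(dotDr mu _ (iter k (mop P) z)).
    rewrite !(dot_iter_fixed _ _ z0) (dotC mu f z) zo.
    suff -> : '[z, iter k (mop P) f] = 0 by rewrite addr0 !add0r.
    by rewrite (eq_dot mu (f' := z) (h' := lap P (iter k (mop P) u))) ?zo // => x;
      exact: iter_mop_lap.
  by move=> x; rewrite (eq_iter_mop _ gE) iter_mopD.
rewrite /pathvar (corr 0%N).
have -> : \sum_(t < T) \sum_(k < t) '[g, iter k.+1 (mop P) g] =
  (\sum_(t < T) t%:R) * '[z, z] + \sum_(t < T) \sum_(k < t) '[f, iter k.+1 (mop P) f].
  rewrite mulr_suml -big_split; apply: eq_bigr => t _ /=.
  rewrite (eq_bigr _ (fun (k : 'I_t) _ => corr k.+1)).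
  by rewrite big_split /= sumr_const card_ord mulr_natl.
by rewrite -[T%:R ^+ 2](subrK T%:R) -sum_ord_nat; ring.
Qed.

Hypothesis mu1 : \sum_x mu x = 1.

Definition centered (g : S -> R) (x : S) : R := g x - \sum_y mu y * g y.

Lemma centered_norm g : '[centered g, centered g] = varpi mu g.
Proof.
have e a : \sum_x mu x * ((g x - a) * (g x - a)) =
    \sum_x mu x * g x ^+ 2 - 2 * a * (\sum_x mu x * g x) + (\sum_x mu x) * a ^+ 2.
  rewrite mulr_sumr mulr_suml -sumrB -big_split /=.
  by apply: eq_bigr => x _; ring.
by rewrite /varpi /dot /centered e mu1; ring.
Qed.

Lemma asymvar_pathvar g :
  asymvar mu P g = limn (fun T => (T%:R^-1 * pathvar (centered g) T)%:E).
Proof.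
rewrite /asymvar; congr (limn _); apply/funext => T.
by rewrite (varavg_centered sP) // (pathE_sum2 sP).
Qed.

(** Here [v] solves the Poisson equation (I - P) v = g almost everywhere, for the centered g. By
    [pathvar_lap] the rescaled variance is then within B / T of the claimed value. *)
Lemma asymvar_fin g v :
  '[centered g \- lap P v, centered g \- lap P v] = 0 ->
  asymvar mu P g = (2 * '[centered g, v] - '[centered g, centered g])%:E.
Proof.
set g0 := centered g => n0.
have zo h : '[g0 \- lap P v, lap P h] = 0 by rewrite null_dotl.
have gl h : '[g0, h] = '[lap P v, h].
  by apply/eqP; rewrite -subr_eq0 -dotBl null_dotl.
have [B hB] := pathvar_lap v.
have -> : 2 * '[g0, v] - '[g0, g0] = 2 * '[lap P v, v] - '[lap P v, lap P v].
  by rewrite !gl (dotC mu _ g0) gl.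
rewrite asymvar_pathvar; apply: cvg_lim => //; apply: cvg_EFin.
  by apply: nearW.
apply/cvgrPdist_le => e e0.
near=> T.
have T0 : (0 < T)%N by near: T; exists 1%N.
have Tp : 0 < T%:R :> R by rewrite ltr0n.
rewrite /= (pathvar_split T zo) n0 mulr0 add0r distrC.
set a := 2 * _ - _.
have -> : T%:R^-1 * pathvar (lap P v) T - a = T%:R^-1 * (pathvar (lap P v) T - T%:R * a).
  by rewrite mulrBr mulrA mulVf ?mul1r // gt_eqF.
rewrite normrM gtr0_norm ?invr_gt0 // mulrC ler_pdivrMr //.
apply: le_trans (hB T) _; rewrite -ler_pdivrMl // mulrC; apply: ltW.
by near: T; exact: nbhs_infty_gtr.
Unshelve. all: by end_near.
Qed.

Lemma asymvar_pinfty g u :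
  (forall h, '[centered g \- lap P u, lap P h] = 0) ->
  '[centered g \- lap P u, centered g \- lap P u] != 0 ->
  asymvar mu P g = +oo%E.
Proof.
set g0 := centered g; set z := g0 \- lap P u => zo nz.
have zp : 0 < '[z, z] by rewrite lt_def nz dot_ge0.
have [B hB] := pathvar_lap u.
rewrite asymvar_pathvar; apply: cvg_lim => //; apply/cvgeryP/cvgryPge => A.
near=> T.
have T0 : (0 < T)%N by near: T; exists 1%N.
have Tp : 0 < T%:R :> R by rewrite ltr0n.
have T1 : 1 <= T%:R :> R by rewrite ler1n.
rewrite /= (pathvar_split T zo) -/z mulrDr expr2 !mulrA mulVf ?gt_eqF // mul1r.
set a := 2 * '[lap P u, u] - '[lap P u, lap P u] in hB.
(* Beyond this threshold T |z|^2 exceeds A - a + B, while the part from (I - P) u contributes at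
   least a - B as soon as T >= 1. *)
have TA : (A - a + B) / '[z, z] < T%:R by near: T; exact: nbhs_infty_gtr.
rewrite ltr_pdivrMr // in TA.
suff : a - B <= T%:R^-1 * pathvar (lap P u) T by move: TA; lra.
rewrite -ler_pdivrMl ?invr_gt0 // invrK.
have B0 : 0 <= B by apply: le_trans (hB 0%N).
have : B <= T%:R * B by rewrite ler_peMl.
by have := hB T; move: (a) => b; rewrite ler_norml mulrBr => /andP[+ _]; lra.
Unshelve. all: by end_near.
Qed.

End AsymptoticVariance.

(** * Reversible kernels compared by their Dirichlet forms *)

Section Comparison.
Variables (R : realType) (S : finType) (mu : S -> R).
Local Notation "''[' f , h ]" := (dot mu f h) (format "''[' f ,  h ]").

Definition reversible (P : S -> S -> R) : Prop :=
  forall f h, '[f, mop P h] = '[mop P f, h].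

Lemma reversible_lap P f h : reversible P -> '[f, lap P h] = '[lap P f, h].
Proof. by move=> rP; rewrite /lap dotBr dotBl rP. Qed.

(** Reversibility is tested on the constant 1 and the indicator of [y]. *)
Lemma reversible_stationary P : (forall x, 0 <= mu x) -> (forall x y, 0 <= P x y) ->
  (forall x, mu x * \sum_y P x y = mu x) -> reversible P -> stationary mu P.
Proof.
move=> m0 P0 row rP; split=> // y.
have := rP (fun=> 1) (fun z => (z == y)%:R); rewrite /dot /mop => e.
transitivity (\sum_x mu x * (1 * \sum_z P x z * (z == y)%:R)).
  apply: eq_bigr => x _; rewrite mul1r (bigD1 y) //= eqxx mulr1 big1 ?addr0 //.
  by move=> z /negbTE ->; rewrite mulr0.
rewrite e (bigD1 y) //= eqxx mulr1 [X in _ + X]big1 ?addr0.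
  by under eq_bigr do rewrite mulr1; rewrite row.
by move=> z /negbTE ->; rewrite !mulr0.
Qed.

(** The integrand vanishes at y = x, so in this form two kernels can be compared through their
    off-diagonal entries alone. *)
Lemma dirichlet_form P f : stationary mu P ->
  '[f, lap P f] = 2^-1 * \sum_x mu x * mop P (fun y => (f x - f y) ^+ 2) x.
Proof.
move=> sP.
have e x : mu x * mop P (fun y => (f x - f y) ^+ 2) x =
    mu x * f x ^+ 2 - 2 * (mu x * (f x * mop P f x)) + mu x * mop P (fun y => f y ^+ 2) x.
  rewrite -{2}(stat_row sP x).
  rewrite /mop !(mulr_sumr, mulr_suml) -sumrB -big_split /=.
  by apply: eq_bigr => y _; ring.
rewrite (eq_bigr _ (fun x _ => e x)) big_split sumrB /= (sum_mop sP) -mulr_sumr.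
rewrite -/(dot mu f (mop P f)) /lap dotBr.
have -> : \sum_x mu x * f x ^+ 2 = '[f, f] by [].
by lra.
Qed.

(* Uses the variational formula <g,(I-P)^-1 g> = sup_f (2<g,f> - <f,(I-P)f>). *)
Lemma asymvar_dirichlet_le (P M : S -> S -> R) (c : R) (g : S -> R) :
  stationary mu P -> reversible P -> stationary mu M -> reversible M ->
  \sum_x mu x = 1 -> 0 < c ->
  (forall f, '[f, lap M f] <= c * '[f, lap P f]) ->
  (asymvar mu P g <= c%:E * asymvar mu M g + ((c - 1) * varpi mu g)%:E)%E.
Proof.
move=> sP rP sM rM mu1 c0 EMP; have mu0 := stat_mu sP.
set g0 := centered mu g.
have [u uo] := lap_projection sM g0.
have [nu|] := eqVneq '[g0 \- lap M u, g0 \- lap M u] 0; last first.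
  move=> nu; rewrite (asymvar_pinfty sM mu1 uo nu) gt0_muley ?lte_fin //.
  by rewrite addye // leey.
have [f fo] := lap_projection sP g0.
set z := g0 \- lap P f in fo.
have gu h : '[g0, h] = '[lap M u, h].
  by apply/eqP; rewrite -subr_eq0 -dotBl null_dotl.
(* A finite variance for [M] forces one for [P]: the residual [z] has zero [P]-energy, hence zero
   [M]-energy, so (I - M) z is null and |z|^2 = <z, g0> = <(I - M) z, u> = 0. *)
have nz : '[z, z] = 0.
  have EP0 : '[z, lap P z] = 0 by rewrite fo.
  have EM0 : '[lap M z, z] = 0.
    apply: le_anti; rewrite (lap_dot_ge0 sM) // andbT dotC.
    by have := EMP z; rewrite EP0 mulr0.
  have nM := null_lap sM EM0.
  by rewrite [RHS](_ : 0 = '[z, g0 \- lap P f]) // dotBr fo subr0 dotC gu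
     -reversible_lap // (null_dotr mu0).
have gf h : '[g0, h] = '[lap P f, h].
  by apply/eqP; rewrite -subr_eq0 -dotBl null_dotl.
rewrite (asymvar_fin sP mu1 nz) (asymvar_fin sM mu1 nu) -EFinM -EFinD lee_fin.
rewrite -(centered_norm mu1) -/g0.
have cn0 : c != 0 by rewrite gt_eqF.
(* The [M]-energy of u - f / c is nonnegative, so <g0, u> >= 2 <g0, f> / c - E_M(f) / c^2 >= <g0, f>
   / c. Then 2 <g0, f> - |g0|^2 <= c (2 <g0, u> - |g0|^2) + (c - 1) |g0|^2. *)
have := lap_dot_ge0 sM (u \- (c^-1 \*o f)).
rewrite (eq_dot mu (f' := lap M u \- (c^-1 \*o lap M f)) (h' := u \- (c^-1 \*o f))) //;
  last by move=> x; rewrite lapB /= lapZ.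
rewrite dotBl !dotBr !dotZl !dotZr -!gu (dotC mu (lap M f) f).
rewrite (dotC mu (lap M f) u) reversible_lap // -gu.
have := EMP f; rewrite (dotC mu f (lap P f)) -gf.
move: '[f, lap M f] '[g0, f] '[g0, u] '[g0, g0] => a b d e h1 h2.
have : c^-1 * a <= b by rewrite -ler_pdivrMl // invrK in h1 *; rewrite ler_pdivrMl.
move=> h3; have : c^-1 * (c^-1 * a) <= c^-1 * b by rewrite ler_pM2l ?invr_gt0.
move=> h4; have h5 : c^-1 * b <= d by lra.
have : b <= c * d by rewrite -ler_pdivrMl.
lra.
Qed.

End Comparison.

(** * Comparison of a lifted kernel with its compression *)

Section Lifting.
Variables (R : realType) (S1 S2 : finType) (phi : S2 -> S1).
Variables (mu1 : S1 -> R) (mu2 : S2 -> R) (Q : S1 -> S1 -> R) (P : S2 -> S2 -> R).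
Hypothesis sQ : stationary mu1 Q.
Hypothesis rQ : reversible mu1 Q.
Hypothesis sP : stationary mu2 P.
Hypothesis pushforward : forall f, \sum_x mu2 x * f (phi x) = \sum_y mu1 y * f y.
Local Notation lift f := (fun x => f (phi x)).
(* Q is the compression to functions of phi of the symmetric part of P. *)
Hypothesis symmetric_part : forall h f,
  dot mu2 h (mop P (lift f)) + dot mu2 (mop P h) (lift f)
  = 2 * dot mu2 h (lift (mop Q f)).
Hypothesis mu1_sum : \sum_x mu1 x = 1.

Lemma asymvar_lifting_le (g : S1 -> R) :
  (asymvar mu2 P (lift g) <= asymvar mu1 Q g)%E.
Proof.
have mu1_0 := stat_mu sQ; have mu2_0 := stat_mu sP.
have dot_lift f h : dot mu2 (lift f) (lift h) = dot mu1 f h.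
  exact: (pushforward (fun y => f y * h y)).
have mu2_sum : \sum_x mu2 x = 1.
  have := pushforward (fun=> 1); rewrite -[RHS]mulr_suml mu1_sum mul1r.
  by rewrite -mulr_suml mulr1.
set g0 := centered mu1 g.
have c0 : centered mu2 (lift g) =1 lift g0.
  by move=> x; rewrite /g0 /centered -pushforward.
have sym h f : dot mu2 h (lap P (lift f)) + dot mu2 (lap P h) (lift f)
    = 2 * dot mu2 h (lift (lap Q f)).
  rewrite [X in _ + X]dotBl [X in X + _]dotBr.
  rewrite [in RHS](eq_dot mu2 (f' := h) (h' := lift f \- lift (mop Q f))) // dotBr.
  by have := symmetric_part h f; lra.
have [f fo] := lap_projection sQ g0.
have [nf|] := eqVneq (dot mu1 (g0 \- lap Q f) (g0 \- lap Q f)) 0; last first.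
  by move=> nf; rewrite (asymvar_pinfty sQ mu1_sum fo nf) leey.
have gf h : dot mu1 g0 h = dot mu1 (lap Q f) h.
  by apply/eqP; rewrite -subr_eq0 -dotBl null_dotl.
have gf2 h : dot mu2 h (lift g0) = dot mu2 h (lift (lap Q f)).
  apply/eqP; rewrite -subr_eq0 -dotBr null_dotr //.
  by rewrite -nf -dot_lift.
have [u uo] := lap_projection sP (lift g0).
set z := lift g0 \- lap P u in uo.
(* In [sym z f] both left-hand terms vanish, since [z] is orthogonal to the range of I - P and fixed
   by P. Hence [z] is orthogonal to the lift of (I - Q) f, that is to the lift of [g0], and so to
   itself. *)
have nz : dot mu2 z z = 0.
  rewrite [LHS](_ : _ = dot mu2 z (lift g0)); last by rewrite {2}/z dotBr uo subr0.
  have := sym z f; rewrite -gf2 uo (null_dotl mu2_0 _ (ortho_null_lap sP uo)).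
  lra.
have gu h : dot mu2 (lift g0) h = dot mu2 (lap P u) h.
  by apply/eqP; rewrite -subr_eq0 -dotBl null_dotl.
have nz' : dot mu2 (centered mu2 (lift g) \- lap P u)
                   (centered mu2 (lift g) \- lap P u) = 0.
  by rewrite -nz; apply: eq_dot => x; rewrite /= c0.
rewrite (asymvar_fin sP mu2_sum nz') (asymvar_fin sQ mu1_sum nf) lee_fin -/g0.
rewrite (eq_dot mu2 c0 (h' := u)) // (eq_dot mu2 c0 c0) dot_lift lerD2r.
rewrite ler_pM2l //.
(* [ub] is the conditional expectation of [u] given [phi]. *)
have [ub ubo] := dot_projection (L := fun f : S1 -> R => lift f) mu2_0
  (fun f h (e : f =1 h) x => e (phi x)) (fun _ _ _ => erefl) (fun _ _ _ => erefl) u.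
have uub h : dot mu2 u (lift h) = dot mu1 ub h.
  by rewrite -dot_lift; apply/eqP; rewrite -subr_eq0 -dotBl ubo.
have E1 : dot mu1 ub (lap Q ub) <= dot mu1 g0 ub.
  have := lap_dot_ge0 sP (u \- lift ub).
  rewrite (eq_dot mu2 (f' := lap P u \- lap P (lift ub)) (h' := u \- lift ub)) //;
    last by move=> x; rewrite lapB.
  rewrite (dotBl mu2) !(dotBr mu2) -!gu (dotC mu2 (lift g0) u) uub dot_lift.
  have := sym u ub; rewrite -gu dot_lift uub (dotC mu2 u).
  have := sym (lift ub) ub; rewrite dot_lift (dotC mu2 (lift ub)) (dotC mu1 ub g0).
  lra.
(* This gives 2 <g0, ub> <= E_Q(ub) + <g0, f>; with [E1], <g0, ub> <= <g0, f>. *)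
have := lap_dot_ge0 sQ (ub \- f).
rewrite (eq_dot mu1 (f' := lap Q ub \- lap Q f) (h' := ub \- f)) //;
  last by move=> x; rewrite lapB.
rewrite dotBl !dotBr -!gf (dotC mu1 (lap Q ub) ub) (dotC mu1 (lap Q ub) f).
rewrite (reversible_lap f ub rQ) -gf (dotC mu2 (lift g0) u) uub (dotC mu1 ub g0).
lra.
Qed.

End Lifting.

(** * Counting labels and pairs of labels *)

Section Configurations.
Variables (n K : nat).
Implicit Types (c : cfg n K) (i : 'I_n) (k : 'I_K).

Lemma setcE c i k : setc c i k i = k.
Proof. by rewrite ffunE eqxx. Qed.

Lemma setc_setc c i k k' : setc (setc c i k) i k' = setc c i k'.
Proof. by apply/ffunP => j; rewrite !ffunE; case: eqP. Qed.

Lemma setc_id c i : setc c i (c i) = c.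
Proof. by apply/ffunP => j; rewrite ffunE; case: eqP => // ->. Qed.

Lemma ncountE c k : ncount c k = (\sum_(i < n | c i == k) 1)%N.
Proof. by rewrite sum1_card. Qed.

Lemma ncountD1 c i k : ncount c k = ((c i == k) + \sum_(j < n | j != i) (c j == k))%N.
Proof.
by rewrite ncountE [LHS]big_mkcond (bigD1 i).
Qed.

(** The additive form avoids truncated subtraction and covers the case where the site already
    carries [k]. *)
Lemma ncount_setc c i k k' :
  (ncount (setc c i k) k' + (c i == k') = ncount c k' + (k == k'))%N.
Proof.
rewrite (ncountD1 _ i) (ncountD1 c i) setcE.
have -> : (\sum_(j < n | j != i) (setc c i k j == k') = \sum_(j < n | j != i) (c j == k'))%N.
  by apply: eq_bigr => j /negbTE ji; rewrite ffunE ji.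
by rewrite addnAC [RHS]addnAC [(_ + (k == k'))%N]addnC.
Qed.

Lemma ncount_gt0 c i : (0 < ncount c (c i))%N.
Proof. by rewrite (ncountD1 c i) eqxx. Qed.

Lemma sum_ncount c : (\sum_k ncount c k = n)%N.
Proof.
under eq_bigr do rewrite ncountE.
rewrite -[RHS]card_ord -sum1_card.
by rewrite (partition_big c xpredT).
Qed.

(** An ordered pair of distinct labels is an element of [kpair K] with one of its two
    orientations. *)
Lemma sum_kpair (R : nmodType) (F : 'I_K -> 'I_K -> R) :
  \sum_(e : kpair K) (F (val e).1 (val e).2 + F (val e).2 (val e).1)
  = \sum_a \sum_(b | b != a) F a b.
Proof.
rewrite big_split /=.
have E (G : 'I_K * 'I_K -> R) :
    \sum_(e : kpair K) G (val e) = \sum_(p : 'I_K * 'I_K | (p.1 < p.2)%N) G p.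
  rewrite [RHS](reindex_omap (val : kpair K -> _) insub) => [|p pP]; last by rewrite insubT.
  by apply: eq_bigl => -[p pP] /=; rewrite insubT ?pP /= eqxx.
rewrite (E (fun p => F p.1 p.2))
  (E (fun p => F p.2 p.1)) pair_big_dep /=.
rewrite [RHS](bigID (fun p : 'I_K * 'I_K => (p.1 < p.2)%N)) /=; congr (_ + _).
  apply: eq_bigl => -[a b] /=; rewrite andbC; case: ltnP => //= ab.
  by apply/esym/eqP => e; rewrite e ltnn in ab.
rewrite (reindex (fun p : 'I_K * 'I_K => (p.2, p.1))) /=; last first.
  by exists (fun p => (p.2, p.1)) => -[].
by apply: eq_bigl => -[a b] /=; rewrite -leqNgt -ltn_neqAle.
Qed.

(** Each label lies in K - 1 pairs and the counts add up to n. *)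
Lemma sum_pc (R : realType) c : (2 <= K)%N -> (1 <= n)%N ->
  \sum_(e : kpair K) pc R c e = 1.
Proof.
move=> K2 n1; rewrite -mulr_suml.
have -> : \sum_(e : kpair K) (ncount c (val e).1 + ncount c (val e).2)%:R
    = ((K - 1) * n)%:R :> R.
  under eq_bigr do rewrite natrD.
  rewrite (sum_kpair (fun a b => (ncount c a)%:R)).
  under eq_bigr => a _.
    rewrite sumr_const (_ : #|[pred b | b != a]| = (K - 1)%N); first over.
    by rewrite cardC1 card_ord subn1.
  by rewrite sumrMnl -natr_sum sum_ncount -mulrnA mulnC.
rewrite divff // pnatr_eq0 muln_eq0 negb_or subn_eq0 -ltnNge K2.
by rewrite -lt0n.
Qed.

Lemma card_kpair : (#|{: kpair K}| = K * (K - 1) %/ 2)%N.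
Proof.
have : (#|{: kpair K}| * 2 = K * (K - 1))%N.
  have := sum_kpair (fun _ _ => 1%N).
  rewrite sum_nat_const => ->.
  transitivity (\sum_(a < K) (K - 1))%N; last by rewrite sum_nat_const card_ord.
  by apply: eq_bigr => a _; rewrite sum1_card cardC1 card_ord subn1.
by move=> <-; rewrite mulnK.
Qed.

End Configurations.

(** * The reversible kernels P_R and P_MG *)

Section Kernels.
Variables (R : realType) (n K : nat) (pi : cfg n K -> R).
Hypotheses (K2 : (2 <= K)%N) (n1 : (1 <= n)%N) (pi0 : forall c, 0 <= pi c).
Implicit Types (c : cfg n K) (i : 'I_n) (a b k : 'I_K).
Local Notation one := (fun _ => 1).

Lemma sum_delta (S : finType) (f : S -> R) d : \sum_y (y == d)%:R * f y = f d.
Proof.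
rewrite (bigD1 d) //= eqxx mul1r big1 ?addr0 // => y /negbTE ->.
by rewrite mul0r.
Qed.

Lemma condp_ge0 c i k : 0 <= condp pi c i k.
Proof. by rewrite divr_ge0 // sumr_ge0. Qed.

Lemma condp_setc c i k k' : condp pi (setc c i k) i k' = condp pi c i k'.
Proof.
rewrite /condp setc_setc; congr (_ / _).
by apply: eq_bigr => j _; rewrite setc_setc.
Qed.

Lemma sum_setc_gt0 c i : pi c != 0 -> 0 < \sum_j pi (setc c i j).
Proof.
move=> pc0; rewrite (bigD1 (c i)) //= setc_id ltr_pwDl ?sumr_ge0 //.
by rewrite lt_def pc0 pi0.
Qed.

Lemma sum_condp c i : pi c != 0 -> \sum_k condp pi c i k = 1.
Proof.
by move=> pc0; rewrite -mulr_suml divff // gt_eqF // sum_setc_gt0.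
Qed.

Definition accrate c i a b : R := Num.min 1 (rratio pi c i a b).

Lemma accrate_ge0 c i a b : 0 <= accrate c i a b.
Proof.
by rewrite le_min ler01 /rratio mulr_ge0 // divr_ge0 // condp_ge0.
Qed.

Lemma accrate_le1 c i a b : accrate c i a b <= 1.
Proof. by rewrite ge_min lexx. Qed.

(** The accepted part of a move from [a] to [b]. When no site carries [a] the inverse is 0, so the
    move counts as rejected, in agreement with the empty-cluster branch of the kernels. *)
Definition accept a b (f : cfg n K -> R) c : R :=
  (ncount c a)%:R^-1 * \sum_(i < n | c i == a) accrate c i a b * f (setc c i b).

(** The state space, the accepted states [s] and the rejected state [r] are kept abstract so that
    one computation serves both [moveR] and [mainK]. *)
Lemma sum_accept_reject (S : finType) (s : 'I_n -> S) (r : S) a b c (f : S -> R) :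
  \sum_y (if ncount c a == 0%N then (y == r)%:R
    else (ncount c a)%:R^-1 * \sum_(i < n | c i == a)
      (accrate c i a b * (y == s i)%:R + (1 - accrate c i a b) * (y == r)%:R)) * f y
  = (ncount c a)%:R^-1 * \sum_(i < n | c i == a) accrate c i a b * f (s i)
    + (1 - accept a b one c) * f r.
Proof.
rewrite /accept; have [->|na] := eqVneq (ncount c a) 0%N.
  by rewrite invr0 !mul0r subr0 mul1r add0r sum_delta.
have e : \sum_(i < n | c i == a) 1 = (ncount c a)%:R :> R.
  by rewrite ncountE natr_sum.
have na' : (ncount c a)%:R != 0 :> R by rewrite pnatr_eq0.
transitivity ((ncount c a)%:R^-1 * \sum_(i < n | c i == a)
    (accrate c i a b * f (s i) + (1 - accrate c i a b) * f r)).
  under eq_bigr do rewrite -mulrA mulr_suml.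
  rewrite -mulr_sumr exchange_big /=; congr (_ * _); apply: eq_bigr => i _.
  rewrite -(sum_delta f (s i)) -[in RHS](sum_delta f r) !mulr_sumr -big_split.
  by apply: eq_bigr => d _ /=; ring.
have -> : \sum_(i < n | c i == a) (accrate c i a b * f (s i) + (1 - accrate c i a b) * f r)
    = \sum_(i < n | c i == a) accrate c i a b * f (s i)
      + ((ncount c a)%:R - \sum_(i < n | c i == a) accrate c i a b * 1) * f r.
  rewrite -e -sumrB mulr_suml -big_split; apply: eq_bigr => i _ /=; ring.
by field.
Qed.

(* The right-hand side is symmetric in the two endpoints of the move: detailed balance. *)
Lemma accrate_flow c i b : 
  pi c * (ncount c (c i))%:R^-1 * accrate c i (c i) b
  = Num.min (pi c / (ncount c (c i))%:R) (pi (setc c i b) / (ncount c b).+1%:R).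
Proof.
have nc : (ncount c (c i))%:R != 0 :> R by rewrite pnatr_eq0 -lt0n ncount_gt0.
have [->|pc0] := eqVneq (pi c) 0.
  by rewrite !mul0r min_l // divr_ge0.
have Z := sum_setc_gt0 i pc0.
rewrite minr_pMr ?divr_ge0 // mulr1; congr (Num.min _ _).
rewrite /rratio /condp setc_id; field.
by rewrite nc pc0 (gt_eqF Z) nat1r pnatr_eq0.
Qed.

(** Relabelling site i is a bijection from configurations with c_i = a to those with c_i = b, and it
    preserves the symmetric flow of [accrate_flow]. The weight [om] will be the probability of
    choosing the pair. *)
Lemma accept_adjoint (om : cfg n K -> R) a b f h : a != b ->
  (forall c i, c i = a -> om (setc c i b) = om c) ->
  \sum_c pi c * om c * (h c * accept a b f c)
  = \sum_c pi c * om c * (accept b a h c * f c).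
Proof.
move=> ab omE.
have flow g k l c : \sum_(i < n | c i == k) pi c * (ncount c k)%:R^-1 * (accrate c i k l * g i)
    = \sum_(i < n | c i == k)
        Num.min (pi c / (ncount c k)%:R) (pi (setc c i l) / (ncount c l).+1%:R) * g i.
  by apply: eq_bigr => i /eqP <-; rewrite mulrA accrate_flow.
transitivity (\sum_(i < n) \sum_(c : cfg n K | c i == a) om c * h c *
   (Num.min (pi c / (ncount c a)%:R) (pi (setc c i b) / (ncount c b).+1%:R) *
    f (setc c i b))).
  rewrite (exchange_big_dep xpredT) //=; apply: eq_bigr => c _.
  rewrite -mulr_sumr -flow /accept -mulr_sumr; ring.
transitivity (\sum_(i < n) \sum_(c : cfg n K | c i == b) om c * f c *
   (Num.min (pi c / (ncount c b)%:R) (pi (setc c i a) / (ncount c a).+1%:R) *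
    h (setc c i a))); last first.
  rewrite (exchange_big_dep xpredT) //=; apply: eq_bigr => c _.
  rewrite -mulr_sumr -flow /accept -mulr_sumr; ring.
apply: eq_bigr => i _.
rewrite [RHS](reindex_onto (fun c => setc c i b) (fun c => setc c i a)); last first.
  by move=> c /eqP <-; rewrite setc_setc setc_id.
apply: eq_big => [c|c /eqP ca].
  rewrite setcE eqxx setc_setc /=; apply/eqP/eqP => [<-|<-].
    by rewrite setc_id.
  by rewrite setcE.
rewrite omE // setc_setc -ca setc_id ca.
(* After the move n_a + 1 and n_b are the old n_a and n_b + 1, so the two arguments of the minimum
   are exchanged. *)
have := ncount_setc c i b b; have := ncount_setc c i b a.
rewrite ca !eqxx (negbTE ab) eq_sym (negbTE ab) !addn0 !addn1 => -> ->.
by rewrite minC; ring.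
Qed.

Definition moveop a b : (cfg n K -> R) -> cfg n K -> R :=
  mop (fun c c' => moveR pi c a b c').

Lemma moveopE a b f c : moveop a b f c = accept a b f c + (1 - accept a b one c) * f c.
Proof. exact: (sum_accept_reject (fun i => setc c i b)). Qed.

Lemma moveop1 a b c : moveop a b one c = 1.
Proof. by rewrite moveopE; ring. Qed.

(** A move between [a] and [b] preserves n_a + n_b; hence a choice of pair that depends on the state
    does not break detailed balance. *)
Lemma pc_setc (e : kpair K) c i a b : (a, b) = val e \/ (b, a) = val e ->
  c i = a -> pc R (setc c i b) e = pc R c e.
Proof.
move=> ab ca; have nab : a != b.
  by case: ab (valP e) => <- /=; apply: contraTneq => ->; rewrite ltnn.
suff E : (ncount (setc c i b) a + ncount (setc c i b) b = ncount c a + ncount c b)%N.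
  by rewrite /pc; case: ab => <- /=; rewrite ?E // ![(_ _ b + _)%N]addnC E.
have := ncount_setc c i b b; have := ncount_setc c i b a.
rewrite ca !eqxx (negbTE nab) eq_sym (negbTE nab) !addn0 !addn1 => e1 e2.
by rewrite e2 addnS -addSn e1.
Qed.

(** The accepted parts of the two orientations are adjoint to each other, and rejection is a
    multiplication operator; only the sum over orientations is self-adjoint. *)
Lemma moveop_adjoint (e : kpair K) f h :
  \sum_c pi c * pc R c e *
    (h c * (moveop (val e).1 (val e).2 f c + moveop (val e).2 (val e).1 f c))
  = \sum_c pi c * pc R c e *
    ((moveop (val e).1 (val e).2 h c + moveop (val e).2 (val e).1 h c) * f c).
Proof.
have e12 : (val e).1 != (val e).2.
  by apply/eqP => ee; have := valP e; rewrite /= ee ltnn.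
have A1 := @accept_adjoint (fun c => pc R c e) _ _ f h e12
  (fun c i => @pc_setc e c i _ _ (or_introl (esym (surjective_pairing _)))).
have e21 : (val e).2 != (val e).1 by rewrite eq_sym.
have A2 := @accept_adjoint (fun c => pc R c e) _ _ f h e21
  (fun c i => @pc_setc e c i _ _ (or_intror (esym (surjective_pairing _)))).
have split_sum (u v u' v' : cfg n K -> R) :
    \sum_c pi c * pc R c e * (u c + v c + (u' c * (h c * f c) + v' c * (h c * f c)))
    = \sum_c pi c * pc R c e * u c + \sum_c pi c * pc R c e * v c
      + \sum_c pi c * pc R c e * (u' c * (h c * f c) + v' c * (h c * f c)).
  by rewrite -!big_split; apply: eq_bigr => c _ /=; ring.
under eq_bigr => c _.
  rewrite (_ : h c * _ = h c * accept (val e).1 (val e).2 f c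
     + h c * accept (val e).2 (val e).1 f c
     + ((1 - accept (val e).1 (val e).2 one c) * (h c * f c)
       + (1 - accept (val e).2 (val e).1 one c) * (h c * f c))).
    over.
  by rewrite !moveopE; ring.
rewrite split_sum A1 A2 -split_sum; apply: eq_bigr => c _.
by rewrite !moveopE; ring.
Qed.

Lemma mop_PR f c : mop (PR pi) f c = \sum_(e : kpair K) pc R c e *
  (2^-1 * (moveop (val e).1 (val e).2 f c + moveop (val e).2 (val e).1 f c)).
Proof.
rewrite /mop /PR; under eq_bigr do rewrite mulr_suml.
rewrite exchange_big; apply: eq_bigr => e _ /=.
rewrite /moveop /mop -big_split /= !mulr_sumr.
by apply: eq_bigr => d _; ring.
Qed.

Lemma reversible_PR : reversible pi (PR pi).
Proof.
move=> h f.
have E u v : dot pi u (mop (PR pi) v) = 2^-1 * \sum_(e : kpair K) \sum_c pi c * pc R c e *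
    (u c * (moveop (val e).1 (val e).2 v c + moveop (val e).2 (val e).1 v c)).
  rewrite exchange_big mulr_sumr; apply: eq_bigr => c _ /=.
  rewrite mop_PR !mulr_sumr; apply: eq_bigr => e _; ring.
rewrite E dotC E; congr (_ * _); apply: eq_bigr => e _.
by rewrite moveop_adjoint; apply: eq_bigr => c _; rewrite (mulrC (f c)).
Qed.

Lemma moveR_ge0 c a b c' : 0 <= moveR pi c a b c'.
Proof.
rewrite /moveR; case: ifP => // _; rewrite mulr_ge0 ?invr_ge0 // sumr_ge0 // => i _.
by rewrite addr_ge0 // mulr_ge0 // ?accrate_ge0 // subr_ge0 accrate_le1.
Qed.

Lemma pc_ge0 c e : 0 <= pc R c e.
Proof. by rewrite divr_ge0. Qed.

Lemma mop_PR1 c : mop (PR pi) one c = 1.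
Proof.
rewrite mop_PR -[RHS](sum_pc R c K2 n1); apply: eq_bigr => e _.
by rewrite !moveop1; field.
Qed.

Lemma stationary_PR : stationary pi (PR pi).
Proof.
apply: reversible_stationary => //; last exact: reversible_PR.
  move=> c c'; apply: sumr_ge0 => e _; rewrite mulr_ge0 ?pc_ge0 //.
  by rewrite addr_ge0 // mulr_ge0 ?invr_ge0 ?moveR_ge0.
move=> c; have := mop_PR1 c; rewrite /mop.
by under eq_bigr do rewrite mulr1; move=> ->; rewrite mulr1.
Qed.

Lemma mop_PMG f c :
  mop (PMG pi) f c = n%:R^-1 * \sum_(i < n) \sum_k condp pi c i k * f (setc c i k).
Proof.
rewrite /mop /PMG; under eq_bigr do rewrite -mulrA mulr_suml.
rewrite -mulr_sumr exchange_big; congr (_ * _); apply: eq_bigr => i _ /=.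
under eq_bigr do rewrite (fun_if (fun x => x * _)) mul0r.
rewrite -big_mkcond (reindex_onto (fun k => setc c i k) (fun d => d i)) /=; last first.
  move=> d /forallP dc; apply/ffunP => j; rewrite ffunE.
  by case: eqP => [->//|/eqP ji]; have := dc j; rewrite ji => /eqP.
apply: eq_big => [k|k _]; last by rewrite setcE.
rewrite setcE eqxx andbT; apply/forallP => j; apply/implyP => /negbTE ji.
by rewrite ffunE ji.
Qed.

(** For fixed i, the involution (c, k) -> (setc c i k, c i) exchanges old and new states and
    preserves pi(c) pi(setc c i k) / Z, where Z depends on c off i only. *)
Lemma reversible_PMG : reversible pi (PMG pi).
Proof.
move=> h f.
have E u v : dot pi u (mop (PMG pi) v) = n%:R^-1 * \sum_(i < n) \sum_(p : cfg n K * 'I_K)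
    pi p.1 * condp pi p.1 i p.2 * (u p.1 * v (setc p.1 i p.2)).
  under [in RHS]eq_bigr => i _ do
    rewrite -(pair_bigA _ (fun c k => pi c * condp pi c i k * (u c * v (setc c i k)))) /=.
  rewrite exchange_big mulr_sumr; apply: eq_bigr => c _ /=.
  rewrite mop_PMG !mulr_sumr; apply: eq_bigr => i _.
  by rewrite !mulr_sumr; apply: eq_bigr => k _; ring.
rewrite E dotC E; congr (_ * _); apply: eq_bigr => i _.
rewrite (reindex (fun p : cfg n K * 'I_K => (setc p.1 i p.2, p.1 i))) /=; last first.
  by exists (fun p : cfg n K * 'I_K => (setc p.1 i p.2, p.1 i)) => -[c k] _ /=;
    rewrite setc_setc setc_id setcE.
apply: eq_bigr => -[c k] _ /=; rewrite setc_setc setc_id.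
rewrite [condp pi (setc c i k) i _]condp_setc /condp setc_id; ring.
Qed.

Lemma stationary_PMG : stationary pi (PMG pi).
Proof.
apply: reversible_stationary => //; last exact: reversible_PMG.
  move=> c c'; rewrite mulr_ge0 ?invr_ge0 // sumr_ge0 // => i _.
  by case: ifP; rewrite ?condp_ge0.
move=> c; have [->|pc0] := eqVneq (pi c) 0; first by rewrite mul0r.
have := mop_PMG one c; rewrite /mop.
under eq_bigr do rewrite mulr1; move=> ->.
under eq_bigr => i _ do under eq_bigr do rewrite mulr1.
under eq_bigr do rewrite sum_condp //.
by rewrite sumr_const card_ord mulVf ?mulr1 // pnatr_eq0 -lt0n.
Qed.

Lemma condp_le_accrate c i b : pi c != 0 ->
  condp pi c i b <= (ncount c (c i) + ncount c b)%:R * (ncount c (c i))%:R^-1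
                    * accrate c i (c i) b.
Proof.
move=> pc0; have nc : 0 < (ncount c (c i))%:R :> R by rewrite ltr0n ncount_gt0.
have nb : 0 <= (ncount c b)%:R :> R by [].
have n1' : 1 <= (ncount c (c i))%:R :> R by rewrite ler1n ncount_gt0.
have le1 k : condp pi c i k <= 1.
  rewrite -(sum_condp i pc0) (bigD1 k) //= lerDl sumr_ge0 // => j _.
  exact: condp_ge0.
have ca : 0 < condp pi c i (c i).
  by rewrite /condp setc_id divr_gt0 ?sum_setc_gt0 // lt_def pc0 pi0.
rewrite minr_pMr ?mulr_ge0 ?invr_ge0 // le_min mulr1 /rratio natrD -natr1.
(* Where the minimum is 1, the bound is pi(b) <= 1 <= (n_a + n_b) / n_a. Otherwise the remaining
   factors are (n_a + n_b) / (n_b + 1), at least 1 because n_a >= 1, and 1 / pi(a) >= 1. *)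
apply/andP; split.
  by apply: le_trans (le1 b) _; rewrite mulrDl mulfV ?gt_eqF // lerDl divr_ge0.
have -> : ((ncount c (c i))%:R + (ncount c b)%:R) * (ncount c (c i))%:R^-1 *
    ((ncount c (c i))%:R / ((ncount c b)%:R + 1) * (condp pi c i b / condp pi c i (c i)))
  = condp pi c i b * (((ncount c (c i))%:R + (ncount c b)%:R) / ((ncount c b)%:R + 1)
      * (condp pi c i (c i))^-1).
  field; rewrite !gt_eqF //; lra.
rewrite ler_peMr ?condp_ge0 // mulr_ege1 //.
  by rewrite ler_pdivlMr; lra.
by rewrite invf_ge1.
Qed.

(** The condition f(c) = 0 discards the diagonal entries. In the constant, K - 1 cancels the
    normalisation of [pc] and 2 cancels the fair choice of orientation. *)
Lemma mop_PMG_le f c : pi c != 0 -> (forall d, 0 <= f d) -> f c = 0 ->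
  mop (PMG pi) f c <= (2 * (K - 1))%:R * mop (PR pi) f c.
Proof.
move=> pc0 f0 fc0.
have nK : (K - 1)%:R != 0 :> R by rewrite pnatr_eq0 subn_eq0 -ltnNge.
have nn : n%:R != 0 :> R by rewrite pnatr_eq0 -lt0n.
have -> : (2 * (K - 1))%:R * mop (PR pi) f c = n%:R^-1 *
    \sum_a \sum_(b | b != a) (ncount c a + ncount c b)%:R * accept a b f c.
  rewrite mop_PR -sum_kpair !mulr_sumr; apply: eq_bigr => e _.
  rewrite !moveopE fc0 /pc (addnC (ncount c (val e).2)).
  by rewrite !natrM; field; rewrite nK nn.
rewrite mop_PMG ler_pM2l ?invr_gt0 ?ltr0n //.
rewrite (partition_big c xpredT) //=; apply: ler_sum => a _.
have -> : \sum_(b | b != a) (ncount c a + ncount c b)%:R * accept a b f c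
  = \sum_(i < n | c i == a) \sum_(b | b != a) (ncount c a + ncount c b)%:R *
      (ncount c a)%:R^-1 * accrate c i a b * f (setc c i b).
  rewrite exchange_big; apply: eq_bigr => b _ /=.
  rewrite /accept !mulr_sumr; apply: eq_bigr => i _; ring.
apply: ler_sum => i /eqP ca.
rewrite (bigD1 a) //= -{2}ca setc_id fc0 mulr0 add0r; apply: ler_sum => b _.
by rewrite -{1 2 3}ca ler_wpM2r // condp_le_accrate.
Qed.

Lemma dirichlet_PMG_le f :
  dot pi f (lap (PMG pi) f) <= (2 * (K - 1))%:R * dot pi f (lap (PR pi) f).
Proof.
rewrite (dirichlet_form _ stationary_PMG) (dirichlet_form _ stationary_PR).
rewrite mulrCA ler_pM2l ?invr_gt0 // mulr_sumr; apply: ler_sum => c _.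
have [->|pc0] := eqVneq (pi c) 0; first by rewrite !mul0r mulr0.
rewrite mulrCA ler_wpM2l // mop_PMG_le // => [d|]; first exact: sqr_ge0.
by rewrite subrr expr0n.
Qed.

End Kernels.

(** * The lifted kernel for a single pair of labels *)

Section Nonreversible.
Variables (R : realType) (n K : nat) (pi : cfg n K -> R) (q : R).
Hypothesis pi0 : forall c, 0 <= pi c.
Implicit Types (c : cfg n K) (v : vel K) (e : kpair K) (f : cfg n K -> R)
  (h u : xstate n K -> R).
Local Notation lift f := (fun x : xstate n K => f x.1).
Local Notation one := (fun _ => 1).

Lemma flipv_e v e : flipv v e e = ~~ v e.
Proof. by rewrite ffunE eqxx. Qed.

Lemma flipvK e : involutive (fun v => flipv v e).
Proof.
move=> v; apply/ffunP => e'; rewrite !ffunE eqxx.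
by case: eqP => // ->; rewrite negbK.
Qed.

Lemma mop_flipK e h (x : xstate n K) :
  mop (flipK q e) h x = (1 - q) * h x + q * h (x.1, flipv x.2 e).
Proof.
rewrite /mop /flipK -(sum_delta h x) -(sum_delta h (_, _)) !mulr_sumr -big_split /=.
by apply: eq_bigr => y _; ring.
Qed.

Definition kminus e v := if v e then (val e).1 else (val e).2.
Definition kplus e v := if v e then (val e).2 else (val e).1.

Lemma kminus_flip e v : kminus e (flipv v e) = kplus e v.
Proof. by rewrite /kminus /kplus flipv_e; case: (v e). Qed.

Lemma kplus_flip e v : kplus e (flipv v e) = kminus e v.
Proof. by rewrite /kminus /kplus flipv_e; case: (v e). Qed.

Lemma mop_mainK e h (x : xstate n K) :
  mop (mainK pi e) h x =
  accept pi (kminus e x.2) (kplus e x.2) (fun c => h (c, x.2)) x.1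
  + (1 - accept pi (kminus e x.2) (kplus e x.2) one x.1) * h (x.1, flipv x.2 e).
Proof.
exact: (@sum_accept_reject _ _ _ pi _ (fun i => (setc x.1 i (kplus e x.2), x.2))).
Qed.

Lemma mop_mainK_lift e f (x : xstate n K) :
  mop (mainK pi e) (lift f) x = moveop pi (kminus e x.2) (kplus e x.2) f x.1.
Proof. by rewrite mop_mainK moveopE. Qed.

Lemma mop_flipK_lift e f : mop (flipK q e) (lift f) =1 lift f.
Proof. by move=> x; rewrite mop_flipK /=; ring. Qed.

Lemma mop_tildeP e h x :
  mop (tildeP pi q e) h x = mop (flipK q e) (mop (mainK pi e) (mop (flipK q e) h)) x.
Proof.
rewrite /mop /tildeP; under eq_bigr do rewrite mulr_suml.
rewrite exchange_big; apply: eq_bigr => z _ /=.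
under eq_bigr do rewrite mulr_suml.
rewrite exchange_big mulr_sumr; apply: eq_bigr => w _ /=.
rewrite !mulr_sumr; apply: eq_bigr => y _; ring.
Qed.

(** The joint weight of a state and the chosen pair. Velocity flips preserve it, and moves along [e]
    preserve its factor [pc], so each [tildeP] can be studied separately under it. *)
Definition pairwt e (x : xstate n K) : R := pitilde pi x * pc R x.1 e.

Lemma sum_flip e (F : xstate n K -> R) : \sum_x F (x.1, flipv x.2 e) = \sum_x F x.
Proof.
rewrite [RHS](reindex (fun x : xstate n K => (x.1, flipv x.2 e))) //.
by exists (fun x : xstate n K => (x.1, flipv x.2 e)) => -[c v] _ /=; rewrite flipvK.
Qed.

Lemma flipK_adjoint e u h :
  dot (pairwt e) (mop (flipK q e) u) h = dot (pairwt e) u (mop (flipK q e) h).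
Proof.
have E (w k : xstate n K -> R) : dot (pairwt e) (mop (flipK q e) w) k = (1 - q) * dot (pairwt e) w k
    + q * \sum_x pairwt e x * (w (x.1, flipv x.2 e) * k x).
  rewrite /dot !mulr_sumr -big_split; apply: eq_bigr => x _ /=.
  by rewrite mop_flipK; ring.
rewrite E [RHS]dotC E (dotC _ h); congr (_ + q * _).
rewrite -[LHS](sum_flip e); apply: eq_bigr => -[c v] _ /=.
by rewrite flipvK (mulrC (u _)).
Qed.

(* Skew detailed balance: the adjoint move is the one with reversed velocity. *)
Lemma mainK_adjoint e u f :
  dot (pairwt e) (mop (mainK pi e) u) (lift f)
  = dot (pairwt e) u (fun x => moveop pi (kplus e x.2) (kminus e x.2) f x.1).
Proof.
pose rej v c := 1 - accept pi (kminus e v) (kplus e v) one c.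
transitivity (\sum_x pairwt e x *
      (accept pi (kminus e x.2) (kplus e x.2) (fun c => u (c, x.2)) x.1 * f x.1)
  + \sum_x pairwt e x * (rej x.2 x.1 * u (x.1, flipv x.2 e) * f x.1)).
  rewrite -big_split; apply: eq_bigr => x _ /=; rewrite mop_mainK /rej; ring.
(* A rejection reverses the velocity; substituting the flipped velocity exchanges [kminus] and
   [kplus], which gives the rejection term of the reversed move. *)
rewrite -[X in _ + X](sum_flip e).
transitivity (\sum_x pairwt e x * (u x * accept pi (kplus e x.2) (kminus e x.2) f x.1)
  + \sum_x pairwt e x * (u x * ((1 - accept pi (kplus e x.2) (kminus e x.2) one x.1) * f x.1)));
  last first.
  rewrite -big_split; apply: eq_bigr => x _ /=; rewrite moveopE; ring.
congr (_ + _); last first.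
  apply: eq_bigr => -[c v] _ /=; rewrite /rej flipvK kminus_flip kplus_flip /pairwt /pitilde /=.
  ring.
have split_x (F : xstate n K -> R) : \sum_x F x = \sum_v \sum_c F (c, v).
  by rewrite exchange_big pair_bigA; apply: eq_bigr => -[].
rewrite !split_x; apply: eq_bigr => v _ /=.
have ab : (kplus e v, kminus e v) = val e \/ (kminus e v, kplus e v) = val e.
  by rewrite /kplus /kminus; case: (v e); [right|left]; case: (val e).
have nab : kplus e v != kminus e v.
  by case: ab (valP e) => <- /=; apply: contraTneq => ->; rewrite ltnn.
have := accept_adjoint pi0 f (fun c => u (c, v)) nab
  (fun c i => @pc_setc R n K e c i _ _ ab).
have scale (F : cfg n K -> R) : \sum_c pairwt e (c, v) * F c
    = (2 ^+ (K * (K - 1) %/ 2))^-1 * \sum_c pi c * pc R c e * F c.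
  by rewrite mulr_sumr; apply: eq_bigr => c _; rewrite /pairwt /pitilde /=; ring.
by rewrite !scale => ->.
Qed.

(** The refreshing flips are self-adjoint and fix functions of c, so they can all be moved onto [h].
    What remains is the move along v plus the move along the reversed v, a sum that no longer
    depends on v. *)
Lemma tildeP_symmetric_part e h f :
  dot (pairwt e) h (mop (tildeP pi q e) (lift f))
  + dot (pairwt e) (mop (tildeP pi q e) h) (lift f)
  = dot (pairwt e) h
      (lift (fun c => moveop pi (val e).1 (val e).2 f c + moveop pi (val e).2 (val e).1 f c)).
Proof.
set s := fun c => _ + _.
have -> : dot (pairwt e) h (mop (tildeP pi q e) (lift f))
    = dot (pairwt e) (mop (flipK q e) h) (mop (mainK pi e) (lift f)).
  rewrite flipK_adjoint; apply: eq_dot => // x; rewrite mop_tildeP.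
  by apply/eq_mop/eq_mop; exact: mop_flipK_lift.
have -> : dot (pairwt e) (mop (tildeP pi q e) h) (lift f) = dot (pairwt e)
    (mop (flipK q e) h) (fun x => moveop pi (kplus e x.2) (kminus e x.2) f x.1).
  rewrite -mainK_adjoint -[RHS](eq_dot _ (frefl _) (mop_flipK_lift e f)) -flipK_adjoint.
  by apply: eq_dot => // x; rewrite mop_tildeP.
rewrite -(eq_dot _ (frefl h) (mop_flipK_lift e s)) -flipK_adjoint -dotDr.
apply: eq_dot => // x /=.
rewrite mop_mainK_lift /s /kplus /kminus.
by case: (x.2 e); rewrite // addrC.
Qed.

Lemma pitilde_ge0 (x : xstate n K) : 0 <= pitilde pi x.
Proof. by rewrite mulr_ge0 // invr_ge0 exprn_ge0. Qed.

Lemma sum_pitilde f : \sum_(x : xstate n K) pitilde pi x * f x.1 = \sum_c pi c * f c.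
Proof.
rewrite -(pair_bigA _ (fun c v => pitilde pi (c, v) * f c)) /=.
apply: eq_bigr => c _; rewrite /pitilde /= sumr_const card_ffun card_bool card_kpair.
rewrite -[_ *+ (2 ^ _)]mulr_natl natrX.
have : 2 ^+ (K * (K - 1) %/ 2) != 0 :> R by rewrite expf_neq0.
by move: (2 ^+ _) => N N0; field.
Qed.

End Nonreversible.

(** * The kernel P_NR as a mixture over pairs *)

Section NonreversibleKernel.
Variables (R : realType) (n K : nat) (pi : cfg n K -> R) (xi : R).
Hypotheses (K2 : (2 <= K)%N) (n1 : (1 <= n)%N) (pi0 : forall c, 0 <= pi c).
Hypothesis xi_n : 0 <= xi <= n%:R.
Local Notation one := (fun _ => 1).
Let q := xi / n%:R.

Lemma mop_PNR (h : xstate n K -> R) x :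
  mop (PNR xi pi) h x = \sum_(e : kpair K) pc R x.1 e * mop (tildeP pi q e) h x.
Proof.
rewrite /mop /PNR; under eq_bigr do rewrite mulr_suml.
rewrite exchange_big; apply: eq_bigr => e _ /=; rewrite mulr_sumr.
by apply: eq_bigr => y _; rewrite mulrA.
Qed.

Lemma PNR_symmetric_part (h : xstate n K -> R) (f : cfg n K -> R) :
  dot (pitilde pi) h (mop (PNR xi pi) (fun x => f x.1))
  + dot (pitilde pi) (mop (PNR xi pi) h) (fun x => f x.1)
  = 2 * dot (pitilde pi) h (fun x => mop (PR pi) f x.1).
Proof.
have E u w : dot (pitilde pi) u (mop (PNR xi pi) w)
    = \sum_(e : kpair K) dot (pairwt pi e) u (mop (tildeP pi q e) w).
  rewrite exchange_big; apply: eq_bigr => x _ /=.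
  rewrite (mop_PNR w x) !mulr_sumr; apply: eq_bigr => e _.
  rewrite /pairwt; ring.
rewrite E dotC E -big_split /=.
under eq_bigr => e _ do rewrite [X in _ + X]dotC tildeP_symmetric_part //.
rewrite exchange_big mulr_sumr; apply: eq_bigr => x _ /=.
rewrite mop_PR !mulr_sumr; apply: eq_bigr => e _.
by rewrite /pairwt; field.
Qed.

Lemma mop_PNR1 x : mop (PNR xi pi) one x = 1.
Proof.
rewrite mop_PNR -[RHS](sum_pc R x.1 K2 n1); apply: eq_bigr => e _.
rewrite mop_tildeP.
have F1 : mop (flipK q e) one =1 (fun _ : xstate n K => 1).
  exact: (mop_flipK_lift q e one).
have M1 : mop (mainK pi e) one =1 one.
  by move=> y; rewrite (mop_mainK_lift pi e one) moveop1.
by rewrite (eq_mop _ (eq_mop _ F1)) (eq_mop _ M1) F1 mulr1.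
Qed.

Lemma PNR_ge0 x y : 0 <= PNR xi pi x y.
Proof.
have n0 : 0 < n%:R :> R by rewrite ltr0n.
have /andP[xi0 xi1] := xi_n.
have q0 : 0 <= q by rewrite divr_ge0.
have q1 : q <= 1 by rewrite ler_pdivrMr // mul1r.
apply: sumr_ge0 => e _; rewrite mulr_ge0 ?pc_ge0 //.
apply: sumr_ge0 => z _; apply: sumr_ge0 => w _.
have F0 (a b : xstate n K) : 0 <= flipK q e a b.
  by rewrite addr_ge0 // mulr_ge0 // subr_ge0.
rewrite !mulr_ge0 ?F0 // /mainK; case: ifP => // _.
rewrite mulr_ge0 ?invr_ge0 // sumr_ge0 // => i _.
rewrite addr_ge0 // mulr_ge0 //; first exact: accrate_ge0.
by rewrite subr_ge0; exact: accrate_le1.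
Qed.

(** Invariance follows from the symmetric-part identity at f = 1: it reads <h, 1> + <P h, 1> = 2 <h,
    1>, and [h] is taken to be the indicator of y. *)
Lemma stationary_PNR : stationary (pitilde pi) (PNR xi pi).
Proof.
split.
- exact: pitilde_ge0.
- exact: PNR_ge0.
- move=> x; have := mop_PNR1 x; rewrite /mop.
  by under eq_bigr do rewrite mulr1; move=> ->; rewrite mulr1.
move=> y; have := PNR_symmetric_part (fun x => (x == y)%:R) one.
rewrite (eq_dot _ (frefl _) mop_PNR1) dotC.
rewrite (@eq_dot _ _ _ _ (fun x => (x == y)%:R) (fun x => mop (PR pi) one x.1) one) //;
  last by move=> x; rewrite mop_PR1.
rewrite (dotC _ (fun x => (x == y)%:R)).
have -> : dot (pitilde pi) one (fun x => (x == y)%:R) = pitilde pi y.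
  rewrite -[RHS](sum_delta (pitilde pi) y); apply: eq_bigr => x _.
  by rewrite mul1r mulrC.
have -> : dot (pitilde pi) (mop (PNR xi pi) (fun x => (x == y)%:R)) one
    = \sum_x pitilde pi x * PNR xi pi x y.
  apply: eq_bigr => x _; rewrite mulr1 -(sum_delta (PNR xi pi x) y); congr (_ * _).
  by apply: eq_bigr => z _; rewrite mulrC.
by lra.
Qed.

End NonreversibleKernel.

Unset Implicit Arguments.

Theorem theorem1 (R : realType) (K n : nat) (pi : {ffun 'I_n -> 'I_K} -> R) (xi : R)
  (g : {ffun 'I_n -> 'I_K} -> R) :
  (2 <= K)%N -> (1 <= n)%N ->
  (forall c, 0 <= pi c) -> \sum_c pi c = 1 ->
  0 <= xi <= n%:R ->
  let cK : R := (2 * (K - 1))%:R in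
  (asymvar (pitilde pi) (PNR xi pi) (fun x => g x.1) <= asymvar pi (PR pi) g)%E /\
  (asymvar pi (PR pi) g
     <= cK%:E * asymvar pi (PMG pi) g + ((cK - 1) * varpi pi g)%:E)%E.
Proof.
move=> K2 n1 pi0 pi1 xi_n cK; split.
  apply: (@asymvar_lifting_le _ _ _ (fun x : xstate n K => x.1)) => //.
  - exact: stationary_PR.
  - exact: reversible_PR.
  - exact: stationary_PNR.
  - exact: sum_pitilde.
  - exact: PNR_symmetric_part.
apply: asymvar_dirichlet_le => //.
- exact: stationary_PR.
- exact: reversible_PR.
- exact: stationary_PMG.
- exact: reversible_PMG.
- by rewrite ltr0n muln_gt0 subn_gt0.
- exact: dirichlet_PMG_le.
Qed.
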